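(* Let $\Gamma$ be a finite biconnected graph with at least three vertices. If $R\in\mathscr C_\Gamma\cap\mathrm{End}(W_\Gamma)$ satisfies $\mathrm{rank}_{\mathbb Q}R=1$ and $R^2=0$, then there exists $\Phi\in\mathrm{Aut}(H_\Gamma)$ such that $\rho_W(\Phi)=I+R$.
   Context: All graphs are finite and simple. For a graph $\Gamma$ with vertex set $V$, $A_\Gamma=\langle V\mid [u,v]=1 \text{ whenever } uv\in E(\Gamma)\rangle$ is the right-angled Artin group, $\chi_\Gamma:A_\Gamma\to\mathbb Z$ is the character with $\chi_\Gamma(v)=1$ for all $v\in V$, and $H_\Gamma=\ker\chi_\Gamma$ is the Bestvina--Brady group. A connected graph with at least three vertices is biconnected if $\Gamma-\{v\}$ is connected for every vertex $v$. Let $\epsilon:\mathbb Z^V\to\mathbb Z$ be the sum of coordinates, $(e_v)$ the standard basis. For connected $\Gamma$, $L_\Gamma=H_1(H_\Gamma;\mathbb Z)$ is identified with $\ker\epsilon$ via $[uv^{-1}]\mapsto e_u-e_v$ ($uv\in E(\Gamma)$), and $W_\Gamma=H^1(H_\Gamma;\mathbb Z)=\mathrm{Hom}(L_\Gamma,\mathbb Z)\cong\mathbb Z^V/\mathbb Z\mathbf 1$. Put $L_{\mathbb Q}=L_\Gamma\otimes\mathbb Q$, $W_{\mathbb Q}=W_\Gamma\otimes\mathbb Q$. The representation $\rho_W:\mathrm{Aut}(H_\Gamma)\to \mathrm{GL}(W_\Gamma)$ is $\rho_W(\alpha)=(\alpha^{-1})^*$. With $\gamma_1G=G$, $\gamma_{d+1}G=[G,\gamma_dG]$,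 and $\mathbb L(L_{\mathbb Q})=\bigoplus_d\mathbb L_d(L_{\mathbb Q})$ the free graded Lie algebra, let $I_d=\ker\big(\mathbb L_d(L_{\mathbb Q})\to(\gamma_dH_\Gamma/\gamma_{d+1}H_\Gamma)\otimes\mathbb Q\big)$ be the kernel of the degree-$d$ part of the canonical Lie algebra map. A vertex separator is a set $S\subseteq V$ with $\Gamma-S$ disconnected; for an inclusion-minimal separator $S$ put $D_S=\mathrm{span}_{\mathbb Q}\{e_v-e_w:v,w\in S\}\le L_{\mathbb Q}$. For $X\in\mathrm{End}(L_{\mathbb Q})$, $X^{[d]}$ is the restriction to $\mathbb L_d(L_{\mathbb Q})$ of the derivation of $\mathbb L(L_{\mathbb Q})$ extending $X$. For $A\in\mathrm{End}(W_{\mathbb Q})$ let $A^{\mathsf T}\in\mathrm{End}(L_{\mathbb Q})$ be the dual endomorphism. The cubic component algebra is $$\mathscr C_\Gamma=\{A\in\mathrm{End}(W_{\mathbb Q}): X=A^{\mathsf T}\text{ satisfies } X^{[2]}I_2\subseteq I_2,\ X^{[3]}I_3\subseteq I_3,\ XD_S\subseteq D_S \text{ for every inclusion-minimal separator } S\};$$ it is a unital associative subalgebra of $\mathrm{End}(W_{\mathbb Q})$. $\mathrm{End}(W_\Gamma)$ is viewed inside $\mathrm{End}(W_{\mathbb Q})$ as the endomorphisms preserving the lattice $W_\Gamma$. *)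

(* Defs.v *)
From HB Require Import structures.
From mathcomp Require Import all_boot all_order all_algebra.
From mathcomp Require Import ring boolp.

Set Implicit Arguments.
Unset Strict Implicit.
Unset Printing Implicit Defensive.

Import GRing.Theory Num.Theory.
Local Open Scope group_scope.
Local Open Scope ring_scope.

Record is_equiv (T : Type) (E : T -> T -> Prop) : Prop := IsEquiv {
  is_equiv_refl : forall x, E x x;
  is_equiv_sym : forall x y, E x y -> E y x;
  is_equiv_trans : forall x y z, E x y -> E y z -> E x z
}.

Section Quot.
Variables (T : choiceType) (E : T -> T -> Prop) (HE : is_equiv E).

Definition quot_rel : rel T := fun x y => `[< E x y >].

Lemma quot_rel_refl : reflexive quot_rel.
Proof. by move=> x; apply/asboolP; apply: is_equiv_refl. Qed.
Lemma quot_rel_sym : symmetric quot_rel.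
Proof. by move=> x y; apply/asboolP/asboolP; apply: is_equiv_sym. Qed.
Lemma quot_rel_trans : transitive quot_rel.
Proof.
move=> y x z /asboolP xy /asboolP yz; apply/asboolP.
exact: is_equiv_trans xy yz.
Qed.

Canonical quot_equiv := EquivRel quot_rel quot_rel_refl quot_rel_sym quot_rel_trans.

Definition quot : Type := {eq_quot quot_equiv}%qT.
HB.instance Definition _ := Choice.on quot.

Definition qcls (x : T) : quot := (\pi_(quot) x)%qT.
Definition qrep (a : quot) : T := repr a.

Lemma qrepK a : qcls (qrep a) = a. Proof. exact: reprK. Qed.

Lemma qclsP x y : qcls x = qcls y <-> E x y.
Proof.
split; first by move/(@eqmodP _ quot_equiv)/asboolP.
by move=> xy; apply/(@eqmodP _ quot_equiv)/asboolP.
Qed.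

Lemma qrepP x : E (qrep (qcls x)) x.
Proof. by apply/qclsP; rewrite qrepK. Qed.

End Quot.

Lemma denqM (q : rat) : (denq q)%:~R * q = (numq q)%:~R.
Proof. by rewrite mulrC -[X in X * _]divq_num_den divfK // intr_eq0 denq_neq0. Qed.

(* Every element of A (x) Q is a pure tensor a (x) q, and a (x) q = b (x) r iff
   both sides agree after clearing denominators by a positive integer N. *)
Section Rationalization.
Variable A : zmodType.
Implicit Types (a b : A) (q r s : rat).

Definition tens_eq (x y : A * rat) : Prop :=
  exists N m n : int, [/\ 0 < N, N%:~R * x.2 = m%:~R, N%:~R * y.2 = n%:~R
                        & x.1 *~ m = y.1 *~ n].

Lemma tens_eq_equiv : is_equiv tens_eq.
Proof.
split=> [[a q]|x y [N [m [n [N0 xm yn e]]]]|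
         x y z [N [m [n [N0 xm yn e]]]] [N' [n' [l [N'0 yn' zl e']]]]].
- exists (denq q), (numq q), (numq q); split=> /=; rewrite ?denqM //.
- by exists N, n, m; split.
- exists (N * N'), (N' * m), (N * l); split; first exact: mulr_gt0.
  + by rewrite !intrM -xm mulrCA mulrA.
  + by rewrite !intrM -zl mulrA.
  + rewrite [N' * m]mulrC (mulrzA x.1) e (mulrzA z.1) [RHS]mulrzAC -e' -!mulrzA.
    congr (_ *~ _); apply/eqP; rewrite -(eqr_int rat) !intrM -yn -yn'.
    by apply/eqP; ring.
Qed.

Definition tensQ := quot tens_eq_equiv.
HB.instance Definition _ := Choice.on tensQ.

Definition tens a q : tensQ := qcls tens_eq_equiv (a, q).

Lemma tens_ind (P : tensQ -> Prop) : (forall a q, P (tens a q)) -> forall x, P x.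
Proof. by move=> h x; rewrite -[x]qrepK; case: (qrep x) => a q; apply: h. Qed.

Lemma tensP a q b r : tens a q = tens b r <-> tens_eq (a, q) (b, r).
Proof. exact: qclsP. Qed.

Lemma tensMz a (m : int) q : tens (a *~ m) q = tens a (m%:~R * q).
Proof.
apply/tensP; exists (denq q), (numq q), (m * numq q).
split=> //=; first exact: denqM.
  by rewrite mulrCA denqM intrM.
by rewrite mulrzA.
Qed.

Lemma tens_den a q (N : int) : N != 0 -> exists b, tens a q = tens b (q / N%:~R).
Proof.
move=> N0; exists (a *~ N); rewrite tensMz mulrC divfK //.
by rewrite intr_eq0.
Qed.

Lemma tens_unit a q : exists b, tens a q = tens b (denq q)%:~R^-1.
Proof. by exists (a *~ numq q); rewrite tensMz divq_num_den. Qed.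

Lemma tens_common (x y : tensQ) : exists a b q, x = tens a q /\ y = tens b q.
Proof.
elim/tens_ind: x => a q; elim/tens_ind: y => b r.
have [a' ->] := tens_unit a q; have [b' ->] := tens_unit b r.
have dq := denq_neq0 q; have dr := denq_neq0 r.
have [a2 ->] := tens_den a' (denq q)%:~R^-1 dr.
have [b2 ->] := tens_den b' (denq r)%:~R^-1 dq.
by exists a2, b2, ((denq q)%:~R^-1 / (denq r)%:~R); split=> //; rewrite mulrC.
Qed.

Definition tens_add (x y : tensQ) : tensQ :=
  let: (a, q) := qrep x in let: (b, r) := qrep y in
  tens (a *~ (numq q * denq r) + b *~ (numq r * denq q))
       ((denq q)%:~R * (denq r)%:~R)^-1.

Lemma tensDl a b q : tens_add (tens a q) (tens b q) = tens (a + b) q.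
Proof.
rewrite /tens_add.
have := qrepP tens_eq_equiv (a, q); case: (qrep _) => a1 q1 /=.
have := qrepP tens_eq_equiv (b, q); case: (qrep _) => b1 r1 /=.
move=> [M [m' [n' [M0 /= rm qn' eb]]]] [N [m [n [N0 /= qm qn ea]]]].
apply/tensP; exists (N * M * denq q1 * denq r1), (N * M), (n * M * denq q1 * denq r1).
have dq : (denq q1)%:~R != 0 :> rat by rewrite intr_eq0 denq_neq0.
have dr : (denq r1)%:~R != 0 :> rat by rewrite intr_eq0 denq_neq0.
have eq1 := denqM q1; have er1 := denqM r1.
split=> /=.
- by rewrite !mulr_gt0 ?denq_gt0.
- by rewrite !intrM; field; rewrite dq dr.
- by rewrite !intrM -qn; ring.
rewrite !mulrzDl -!(mulrzA a1) -!(mulrzA b1). congr (_ + _).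
- have -> : numq q1 * denq r1 * (N * M) = m * (M * denq q1 * denq r1).
    by apply/eqP; rewrite -(eqr_int rat) !intrM -qm -eq1; apply/eqP; ring.
  by rewrite mulrzA ea -mulrzA !mulrA.
- have -> : numq r1 * denq q1 * (N * M) = m' * (N * denq q1 * denq r1).
    by apply/eqP; rewrite -(eqr_int rat) !intrM -rm -er1; apply/eqP; ring.
  rewrite mulrzA eb -mulrzA; congr (_ *~ _).
  by apply/eqP; rewrite -(eqr_int rat) !intrM -qn' -qn; apply/eqP; ring.
Qed.

Lemma tens_addC : commutative tens_add.
Proof.
move=> x y; have [a [b [q [-> ->]]]] := tens_common x y.
by rewrite !tensDl addrC.
Qed.

Lemma tens_common3 (x y z : tensQ) :
  exists a b c q, [/\ x = tens a q, y = tens b q & z = tens c q].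
Proof.
have [a [b [q [-> ->]]]] := tens_common x y; elim/tens_ind: z => c r.
have [a' ->] := tens_unit a q; have [b' ->] := tens_unit b q.
have [c' ->] := tens_unit c r.
have dq := denq_neq0 q; have dr := denq_neq0 r.
have [a2 ->] := tens_den a' (denq q)%:~R^-1 dr.
have [b2 ->] := tens_den b' (denq q)%:~R^-1 dr.
have [c2 ->] := tens_den c' (denq r)%:~R^-1 dq.
exists a2, b2, c2, ((denq q)%:~R^-1 / (denq r)%:~R).
by split=> //; rewrite mulrC.
Qed.

Lemma tens_addA : associative tens_add.
Proof.
move=> x y z; have [a [b [c [q [-> -> ->]]]]] := tens_common3 x y z.
by rewrite !tensDl addrA.
Qed.

Lemma tens0l q : tens 0 q = tens 0 0.
Proof.
apply/tensP; exists (denq q), (numq q), 0; split=> //=.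
- exact: denqM.
- by rewrite mulr0.
- by rewrite !mul0rz.
Qed.

Lemma tens_add0 : left_id (tens 0 0) tens_add.
Proof.
by elim/tens_ind=> a q; rewrite -(tens0l q) tensDl add0r.
Qed.

Definition tens_scale (s : rat) (x : tensQ) : tensQ :=
  tens (qrep x).1 (s * (qrep x).2).

Lemma tens_scaleE s a q : tens_scale s (tens a q) = tens a (s * q).
Proof.
rewrite /tens_scale; have := qrepP tens_eq_equiv (a, q).
case: (qrep _) => a1 q1 [N [m [n [/= N0 qm qn e]]]].
apply/tensP; exists (denq s * N), (numq s * m), (numq s * n).
have es := denqM s.
split=> /=.
- by rewrite mulr_gt0 ?denq_gt0.
- by rewrite !intrM mulrACA es qm.
- by rewrite !intrM mulrACA es qn.
- by rewrite ![numq s * _]mulrC !mulrzA e.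
Qed.

Lemma tensDr a q r : tens_add (tens a q) (tens a r) = tens a (q + r).
Proof.
have [m [n [N [-> ->]]]] : exists (m n : int) (N : rat), q = m%:~R * N /\ r = n%:~R * N.
  exists (numq q * denq r), (numq r * denq q), ((denq q)%:~R * (denq r)%:~R)^-1.
  have dq : (denq q)%:~R != 0 :> rat by rewrite intr_eq0 denq_neq0.
  have dr : (denq r)%:~R != 0 :> rat by rewrite intr_eq0 denq_neq0.
  by rewrite !intrM -!denqM; split; field; rewrite dq dr.
by rewrite -!tensMz tensDl -mulrzDr tensMz intrD mulrDl.
Qed.

Lemma tens_addN : left_inverse (tens 0 0) (tens_scale (-1)) tens_add.
Proof.
elim/tens_ind=> a q; rewrite tens_scaleE tensDr mulN1r addNr.
by apply/tensP; exists 1, 0, 0; split=> //=; rewrite ?mulr0.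
Qed.

HB.instance Definition _ :=
  GRing.isZmodule.Build tensQ tens_addA tens_addC tens_add0 tens_addN.

Lemma tens_addl a b q : tens (a + b) q = tens a q + tens b q.
Proof. by rewrite -tensDl. Qed.
Lemma tens_addr a q r : tens a (q + r) = tens a q + tens a r.
Proof. by rewrite -tensDr. Qed.

Fact tens_scaleA s t x : tens_scale s (tens_scale t x) = tens_scale (s * t) x.
Proof. by elim/tens_ind: x => a q; rewrite !tens_scaleE mulrA. Qed.
Fact tens_scale1 : left_id 1 tens_scale.
Proof. by elim/tens_ind=> a q; rewrite tens_scaleE mul1r. Qed.
Fact tens_scaleDr : right_distributive tens_scale +%R.
Proof.
move=> s x y; have [a [b [q [-> ->]]]] := tens_common x y.
by rewrite -tens_addl !tens_scaleE -tens_addl.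
Qed.
Fact tens_scaleDl x : {morph tens_scale^~ x : s t / s + t}.
Proof.
by move=> s t; elim/tens_ind: x => a q; rewrite !tens_scaleE -tens_addr mulrDl.
Qed.

HB.instance Definition _ := GRing.Zmodule_isLmodule.Build rat tensQ
  tens_scaleA tens_scale1 tens_scaleDr tens_scaleDl.

Lemma tens_scalerE s a q : s *: tens a q = tens a (s * q).
Proof. exact: tens_scaleE. Qed.
Lemma tens0 q : tens 0 q = 0. Proof. exact: tens0l. Qed.
Lemma tensN a q : tens (- a) q = - tens a q.
Proof. by apply/eqP; rewrite -addr_eq0 -tens_addl addNr tens0. Qed.

End Rationalization.

Arguments tens {A} a q.

Section TensBilinear.
Variables (A B C : zmodType) (f : A -> B -> C).
Hypothesis fDl : forall a a' b, f (a + a') b = f a b + f a' b.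
Hypothesis fDr : forall a b b', f a (b + b') = f a b + f a b'.

Definition tens2 (x : tensQ A) (y : tensQ B) : tensQ C :=
  tens (f (qrep x).1 (qrep y).1) ((qrep x).2 * (qrep y).2).

Lemma tens2_Mzl a b m : f (a *~ m) b = f a b *~ m.
Proof.
have f0 : f 0 b = 0 by apply: (addrI (f 0 b)); rewrite -fDl !addr0.
have fN x : f (- x) b = - f x b.
  by apply/eqP; rewrite -addr_eq0 -fDl addNr f0.
have fn x n : f (x *+ n) b = f x b *+ n.
  by elim: n => [|n IH]; rewrite ?mulr0n ?f0 // !mulrSr fDl IH.
by case: m => n; rewrite ?NegzE ?mulrNz -!pmulrn ?fN fn.
Qed.

Lemma tens2_Mzr a b m : f a (b *~ m) = f a b *~ m.
Proof.
have f0 : f a 0 = 0 by apply: (addrI (f a 0)); rewrite -fDr !addr0.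
have fN x : f a (- x) = - f a x.
  by apply/eqP; rewrite -addr_eq0 -fDr addNr f0.
have fn x n : f a (x *+ n) = f a x *+ n.
  by elim: n => [|n IH]; rewrite ?mulr0n ?f0 // !mulrSr fDr IH.
by case: m => n; rewrite ?NegzE ?mulrNz -!pmulrn ?fN fn.
Qed.

Lemma tens2E a q b r : tens2 (tens a q) (tens b r) = tens (f a b) (q * r).
Proof.
rewrite /tens2.
have := qrepP (tens_eq_equiv A) (a, q).
case: (qrep _) => a1 q1 [N [m [n [/= N0 qm qn e]]]].
have := qrepP (tens_eq_equiv B) (b, r).
case: (qrep _) => b1 r1 [N' [m' [n' [/= N'0 qm' qn' e']]]].
apply/tensP; exists (N * N'), (m * m'), (n * n'); split=> /=.
- exact: mulr_gt0.
- by rewrite !intrM mulrACA qm qm'.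
- by rewrite !intrM mulrACA qn qn'.
- by rewrite !mulrzA -(tens2_Mzl a1) -(tens2_Mzr _ b1) e e' tens2_Mzr tens2_Mzl.
Qed.

Lemma tens2Dl x x' y : tens2 (x + x') y = tens2 x y + tens2 x' y.
Proof.
have [a [a' [q [-> ->]]]] := tens_common x x'; elim/tens_ind: y => b r.
by rewrite -tens_addl !tens2E fDl tens_addl.
Qed.
Lemma tens2Dr x y y' : tens2 x (y + y') = tens2 x y + tens2 x y'.
Proof.
have [b [b' [r [-> ->]]]] := tens_common y y'; elim/tens_ind: x => a q.
by rewrite -tens_addl !tens2E fDr tens_addl.
Qed.
Lemma tens2Zl s x y : tens2 (s *: x) y = s *: tens2 x y.
Proof.
elim/tens_ind: x => a q; elim/tens_ind: y => b r.
by rewrite tens_scalerE !tens2E tens_scalerE mulrA.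
Qed.
Lemma tens2Zr s x y : tens2 x (s *: y) = s *: tens2 x y.
Proof.
elim/tens_ind: x => a q; elim/tens_ind: y => b r.
by rewrite tens_scalerE !tens2E tens_scalerE mulrCA.
Qed.

End TensBilinear.

HB.mixin Record Lmodule_isLie (K : comNzRingType) L of GRing.Lmodule K L := {
  lie : L -> L -> L;
  lieDl : forall x x' y, lie (x + x') y = lie x y + lie x' y;
  lieDr : forall x y y', lie x (y + y') = lie x y + lie x y';
  lieZl : forall a x y, lie (a *: x) y = a *: lie x y;
  lieZr : forall a x y, lie x (a *: y) = a *: lie x y;
  liexx : forall x, lie x x = 0;
  lie_jacobi : forall x y z,
    lie x (lie y z) + lie y (lie z x) + lie z (lie x y) = 0
}.

#[short(type="lieAlgType")]
HB.structure Definition LieAlgebra (K : comNzRingType) :=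
  {L of GRing.Lmodule K L & Lmodule_isLie K L}.

Section LieTheory.
Variables (K : comNzRingType) (L : lieAlgType K).
Implicit Types x y : L.

Lemma lieC x y : lie x y = - lie y x.
Proof.
apply/eqP; rewrite -addr_eq0; have := liexx (x + y).
by rewrite lieDl !lieDr !liexx add0r addr0 => ->.
Qed.
Lemma lie0l y : lie (0 : L) y = 0.
Proof. by apply: (addrI (lie 0 y)); rewrite -lieDl !addr0. Qed.
Lemma lie0r x : lie x (0 : L) = 0.
Proof. by rewrite lieC lie0l oppr0. Qed.

End LieTheory.

Section FreeLie.
Variables (K : comNzRingType) (U : lmodType K).

Inductive lie_term : Type :=
| LVar of U
| LZero
| LAdd of lie_term & lie_term
| LScale of K & lie_term
| LBr of lie_term & lie_term.

HB.instance Definition _ := gen_eqMixin lie_term.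
HB.instance Definition _ := gen_choiceMixin lie_term.

(* The least congruence making terms a Lie algebra and LVar linear; the
   opposite of s is -1 times s. *)
Inductive lie_eq : lie_term -> lie_term -> Prop :=
| LErefl s : lie_eq s s
| LEsym s t : lie_eq s t -> lie_eq t s
| LEtrans s t u : lie_eq s t -> lie_eq t u -> lie_eq s u
| LEadd s s' t t' : lie_eq s s' -> lie_eq t t' -> lie_eq (LAdd s t) (LAdd s' t')
| LEscale a s s' : lie_eq s s' -> lie_eq (LScale a s) (LScale a s')
| LEbr s s' t t' : lie_eq s s' -> lie_eq t t' -> lie_eq (LBr s t) (LBr s' t')
| LEaddA s t u : lie_eq (LAdd s (LAdd t u)) (LAdd (LAdd s t) u)
| LEaddC s t : lie_eq (LAdd s t) (LAdd t s)
| LEadd0 s : lie_eq (LAdd LZero s) s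
| LEaddN s : lie_eq (LAdd (LScale (-1) s) s) LZero
| LEscaleA a b s : lie_eq (LScale a (LScale b s)) (LScale (a * b) s)
| LEscale1 s : lie_eq (LScale 1 s) s
| LEscaleDr a s t : lie_eq (LScale a (LAdd s t)) (LAdd (LScale a s) (LScale a t))
| LEscaleDl a b s : lie_eq (LScale (a + b) s) (LAdd (LScale a s) (LScale b s))
| LEbrDl s s' t : lie_eq (LBr (LAdd s s') t) (LAdd (LBr s t) (LBr s' t))
| LEbrDr s t t' : lie_eq (LBr s (LAdd t t')) (LAdd (LBr s t) (LBr s t'))
| LEbrZl a s t : lie_eq (LBr (LScale a s) t) (LScale a (LBr s t))
| LEbrZr a s t : lie_eq (LBr s (LScale a t)) (LScale a (LBr s t))
| LEbrxx s : lie_eq (LBr s s) LZero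
| LEjacobi s t u : lie_eq
    (LAdd (LAdd (LBr s (LBr t u)) (LBr t (LBr u s))) (LBr u (LBr s t))) LZero
| LEvarD u v : lie_eq (LVar (u + v)) (LAdd (LVar u) (LVar v))
| LEvarZ a u : lie_eq (LVar (a *: u)) (LScale a (LVar u)).

Lemma lie_eq_equiv : is_equiv lie_eq.
Proof. by split; [apply: LErefl | apply: LEsym | apply: LEtrans]. Qed.

Definition freeLie := quot lie_eq_equiv.
HB.instance Definition _ := Choice.on freeLie.

Definition fl_cls (s : lie_term) : freeLie := qcls lie_eq_equiv s.
Local Notation cls := fl_cls.
Implicit Types x y z : freeLie.

Definition fl_add x y : freeLie := cls (LAdd (qrep x) (qrep y)).
Definition fl_scale a x : freeLie := cls (LScale a (qrep x)).
Definition fl_br x y : freeLie := cls (LBr (qrep x) (qrep y)).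

Lemma fl_addE s t : fl_add (cls s) (cls t) = cls (LAdd s t).
Proof. by apply/qclsP/LEadd; apply: qrepP. Qed.
Lemma fl_scaleE a s : fl_scale a (cls s) = cls (LScale a s).
Proof. by apply/qclsP/LEscale; apply: qrepP. Qed.
Lemma fl_brE s t : fl_br (cls s) (cls t) = cls (LBr s t).
Proof. by apply/qclsP/LEbr; apply: qrepP. Qed.

Definition flE := (fl_addE, fl_scaleE, fl_brE).

Lemma fl_cls_ind (P : freeLie -> Prop) : (forall s, P (cls s)) -> forall x, P x.
Proof. by move=> h x; rewrite -[x]qrepK. Qed.

Fact fl_addA : associative fl_add.
Proof.
by do 3!elim/fl_cls_ind=> ?; rewrite !flE; apply/qclsP/LEaddA.
Qed.
Fact fl_addC : commutative fl_add.
Proof. by do 2!elim/fl_cls_ind=> ?; rewrite !flE; apply/qclsP/LEaddC. Qed.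
Fact fl_add0 : left_id (cls LZero) fl_add.
Proof. by elim/fl_cls_ind=> ?; rewrite !flE; apply/qclsP/LEadd0. Qed.
Fact fl_addN : left_inverse (cls LZero) (fl_scale (-1)) fl_add.
Proof. by elim/fl_cls_ind=> ?; rewrite !flE; apply/qclsP/LEaddN. Qed.

HB.instance Definition _ :=
  GRing.isZmodule.Build freeLie fl_addA fl_addC fl_add0 fl_addN.

Fact fl_scaleA a b x : fl_scale a (fl_scale b x) = fl_scale (a * b) x.
Proof. by elim/fl_cls_ind: x => s; rewrite !flE; apply/qclsP/LEscaleA. Qed.
Fact fl_scale1 : left_id 1 fl_scale.
Proof. by elim/fl_cls_ind=> s; rewrite !flE; apply/qclsP/LEscale1. Qed.
Fact fl_scaleDr : right_distributive fl_scale +%R.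
Proof.
move=> a; do 2!elim/fl_cls_ind=> ?.
by rewrite /GRing.add /= !flE; apply/qclsP/LEscaleDr.
Qed.
Fact fl_scaleDl x : {morph fl_scale^~ x : a b / a + b}.
Proof.
move=> a b; elim/fl_cls_ind: x => s.
by rewrite [in RHS]/GRing.add /= !flE; apply/qclsP/LEscaleDl.
Qed.

HB.instance Definition _ := GRing.Zmodule_isLmodule.Build K freeLie
  fl_scaleA fl_scale1 fl_scaleDr fl_scaleDl.

Fact fl_brDl x x' y : fl_br (x + x') y = fl_br x y + fl_br x' y.
Proof.
move: x x' y; do 3!elim/fl_cls_ind=> ?.
by rewrite /GRing.add /= !flE; apply/qclsP/LEbrDl.
Qed.
Fact fl_brDr x y y' : fl_br x (y + y') = fl_br x y + fl_br x y'.
Proof.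
move: x y y'; do 3!elim/fl_cls_ind=> ?.
by rewrite /GRing.add /= !flE; apply/qclsP/LEbrDr.
Qed.
Fact fl_brZl a x y : fl_br (a *: x) y = a *: fl_br x y.
Proof.
move: x y; do 2!elim/fl_cls_ind=> ?.
by rewrite /GRing.scale /= !flE; apply/qclsP/LEbrZl.
Qed.
Fact fl_brZr a x y : fl_br x (a *: y) = a *: fl_br x y.
Proof.
move: x y; do 2!elim/fl_cls_ind=> ?.
by rewrite /GRing.scale /= !flE; apply/qclsP/LEbrZr.
Qed.
Fact fl_brxx x : fl_br x x = 0.
Proof. by elim/fl_cls_ind: x => s; rewrite !flE; apply/qclsP/LEbrxx. Qed.
Fact fl_jacobi x y z :
  fl_br x (fl_br y z) + fl_br y (fl_br z x) + fl_br z (fl_br x y) = 0.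
Proof.
move: x y z; do 3!elim/fl_cls_ind=> ?.
by rewrite /GRing.add /= !flE; apply/qclsP/LEjacobi.
Qed.

HB.instance Definition _ := Lmodule_isLie.Build K freeLie
  fl_brDl fl_brDr fl_brZl fl_brZr fl_brxx fl_jacobi.

Lemma clsD s t : cls (LAdd s t) = cls s + cls t.
Proof. by rewrite -fl_addE. Qed.
Lemma clsZ a s : cls (LScale a s) = a *: cls s.
Proof. by rewrite -fl_scaleE. Qed.
Lemma clsB s t : cls (LBr s t) = lie (cls s) (cls t).
Proof. by rewrite -fl_brE. Qed.
Lemma cls0 : cls LZero = 0. Proof. by []. Qed.
Let clsE := (clsD, clsZ, clsB, cls0).

Definition fl_var (u : U) : freeLie := cls (LVar u).

Fact fl_var_linear : linear fl_var.
Proof.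
move=> a u v; rewrite /fl_var -clsZ -clsD; apply/qclsP.
by apply: (LEtrans (LEvarD _ _)); apply: LEadd; [apply: LEvarZ | apply: LErefl].
Qed.
HB.instance Definition _ := GRing.isLinear.Build K U freeLie _ fl_var fl_var_linear.

Lemma freeLie_ind (P : freeLie -> Prop) :
    (forall u, P (fl_var u)) -> P 0 ->
    (forall x y, P x -> P y -> P (x + y)) ->
    (forall a x, P x -> P (a *: x)) ->
    (forall x y, P x -> P y -> P (lie x y)) ->
  forall x, P x.
Proof.
move=> Pv P0 PD PZ PB; elim/fl_cls_ind; elim=> [u||s hs t ht|a s hs|s hs t ht].
- exact: Pv.
- exact: P0.
- by rewrite clsD; apply: PD.
- by rewrite clsZ; apply: PZ.
- by rewrite clsB; apply: PB.
Qed.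

Inductive freeLie_deg : nat -> freeLie -> Prop :=
| FLdeg_var u : freeLie_deg 1 (fl_var u)
| FLdeg_br p q x y : freeLie_deg p x -> freeLie_deg q y ->
    freeLie_deg (p + q) (lie x y)
| FLdeg0 d : freeLie_deg d 0
| FLdegD d x y : freeLie_deg d x -> freeLie_deg d y -> freeLie_deg d (x + y)
| FLdegZ d a x : freeLie_deg d x -> freeLie_deg d (a *: x).

Section Lift.
Variables (M : lieAlgType K) (f : {linear U -> M}).

Fixpoint lie_eval (s : lie_term) : M :=
  match s with
  | LVar u => f u
  | LZero => 0
  | LAdd s t => lie_eval s + lie_eval t
  | LScale a s => a *: lie_eval s
  | LBr s t => lie (lie_eval s) (lie_eval t)
  end.

Definition freeLie_lift (x : freeLie) : M := lie_eval (qrep x).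

Lemma lie_eval_eq s t : lie_eq s t -> lie_eval s = lie_eval t.
Proof.
elim=> //=.
- by move=> ? ? ? _ -> _ ->.
- by move=> ? ? ? ? _ -> _ ->.
- by move=> ? ? ? _ ->.
- by move=> ? ? ? ? _ -> _ ->.
- by move=> *; rewrite addrA.
- by move=> *; rewrite addrC.
- by move=> *; rewrite add0r.
- by move=> *; rewrite scaleN1r addNr.
- by move=> *; rewrite scalerA.
- by move=> *; rewrite scale1r.
- by move=> *; rewrite scalerDr.
- by move=> *; rewrite scalerDl.
- by move=> *; rewrite lieDl.
- by move=> *; rewrite lieDr.
- by move=> *; rewrite lieZl.
- by move=> *; rewrite lieZr.
- by move=> *; rewrite liexx.
- by move=> *; rewrite lie_jacobi.
- by move=> *; rewrite linearD.
- by move=> *; rewrite linearZ.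
Qed.

Lemma freeLie_liftE s : freeLie_lift (cls s) = lie_eval s.
Proof. by apply: lie_eval_eq; apply: qrepP. Qed.

Lemma freeLie_lift_var u : freeLie_lift (fl_var u) = f u.
Proof. exact: freeLie_liftE. Qed.
Fact freeLie_lift_linear : linear freeLie_lift.
Proof.
move=> a; do 2!elim/fl_cls_ind=> ?.
by rewrite -clsZ -clsD !freeLie_liftE.
Qed.
HB.instance Definition _ :=
  GRing.isLinear.Build K freeLie M _ freeLie_lift freeLie_lift_linear.
Lemma freeLie_lift_lie x y :
  freeLie_lift (lie x y) = lie (freeLie_lift x) (freeLie_lift y).
Proof.
move: x y; do 2!elim/fl_cls_ind=> ?.
by rewrite -clsB !freeLie_liftE.
Qed.

End Lift.

Section Derivation.
Variable X : {linear U -> U}.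

Fixpoint der_term (s : lie_term) : lie_term :=
  match s with
  | LVar u => LVar (X u)
  | LZero => LZero
  | LAdd s t => LAdd (der_term s) (der_term t)
  | LScale a s => LScale a (der_term s)
  | LBr s t => LAdd (LBr (der_term s) t) (LBr s (der_term t))
  end.

Definition freeLie_der (x : freeLie) : freeLie := cls (der_term (qrep x)).


Lemma der_term_eq s t : lie_eq s t -> cls (der_term s) = cls (der_term t).
Proof.
elim=> /=; rewrite ?clsE //.
- by move=> ? ? ? _ -> _ ->.
- by move=> ? ? ? ? _ h _ h'; rewrite !clsE h h'.
- by move=> ? ? ? _ h; rewrite !clsE h.
- move=> s1 s2 t1 t2 e h e' h'; rewrite !clsE h h'.
  have -> : cls s1 = cls s2 by apply/qclsP.
  by have -> : cls t1 = cls t2 by apply/qclsP.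
- by move=> *; rewrite !clsE addrA.
- by move=> *; rewrite !clsE addrC.
- by move=> *; rewrite !clsE add0r.
- by move=> *; rewrite !clsE scaleN1r addNr.
- by move=> *; rewrite !clsE scalerA.
- by move=> *; rewrite !clsE scale1r.
- by move=> *; rewrite !clsE scalerDr.
- by move=> *; rewrite !clsE scalerDl.
- by move=> *; rewrite !clsE !lieDl addrACA.
- by move=> *; rewrite !clsE !lieDr addrACA.
- by move=> *; rewrite !clsE !lieZl scalerDr.
- by move=> *; rewrite !clsE !lieZr scalerDr.
- by move=> s1; rewrite !clsE lieC addNr.
- move=> s1 s2 s3; rewrite !clsE !lieDr.
  set x := cls s1; set y := cls s2; set z := cls s3.
  set x' := cls (der_term s1); set y' := cls (der_term s2); set z' := cls (der_term s3).
  have e1 := lie_jacobi x' y z; have e2 := lie_jacobi x y' z.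
  have e3 := lie_jacobi x y z'.
  have -> : 0 = 0 + 0 + 0 :> freeLie by rewrite !addr0.
  rewrite -[X in _ = X + _ + _]e1 -[X in _ = _ + X + _]e2 -[X in _ = _ + _ + X]e3.
  rewrite !addrA.
  by rewrite [LHS](ACl (1*6*8*2*4*9*3*5*7))%AC.
- by move=> *; rewrite !clsE -[cls (LVar _)]/(fl_var _) !linearD.
- by move=> *; rewrite !clsE -[cls (LVar _)]/(fl_var _) !linearZ.
Qed.

Lemma freeLie_derE s : freeLie_der (cls s) = cls (der_term s).
Proof. by apply: der_term_eq; apply: qrepP. Qed.

Lemma freeLie_der_var u : freeLie_der (fl_var u) = fl_var (X u).
Proof. exact: freeLie_derE. Qed.
Fact freeLie_der_linear : linear freeLie_der.
Proof.
move=> a; do 2!elim/fl_cls_ind=> ?.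
by rewrite -clsZ -clsD !freeLie_derE /= !clsE.
Qed.
HB.instance Definition _ :=
  GRing.isLinear.Build K freeLie freeLie _ freeLie_der freeLie_der_linear.
Lemma freeLie_der_lie x y :
  freeLie_der (lie x y) = lie (freeLie_der x) y + lie x (freeLie_der y).
Proof.
move: x y; do 2!elim/fl_cls_ind=> ?.
by rewrite -clsB !freeLie_derE /= !clsE.
Qed.

End Derivation.
End FreeLie.

Section LowerCentralSeries.
Variable G : groupType.
Local Open Scope group_scope.
Implicit Types x y z : G.

Inductive gen_by (S : G -> Prop) : G -> Prop :=
| gen_in x : S x -> gen_by S x
| gen_1 : gen_by S 1
| gen_M x y : gen_by S x -> gen_by S y -> gen_by S (x * y)
| gen_V x : gen_by S x -> gen_by S x^-1.

(* Indexed so that lcs 1 = G; the value lcs 0 = G is a convention making the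
   degree-0 quotient trivial. *)
Fixpoint lcs (d : nat) : G -> Prop :=
  match d with
  | 0 => fun _ => True
  | d'.+1 =>
    if d' is 0 then fun _ => True
    else gen_by (fun z => exists x y, lcs d' y /\ z = [~ x, y])
  end.

Lemma lcs_1 d : lcs d 1.
Proof. by case: d => [|[|d]] //; apply: gen_1. Qed.
Lemma lcs_M d x y : lcs d x -> lcs d y -> lcs d (x * y).
Proof. by case: d => [|[|d]] //; apply: gen_M. Qed.
Lemma lcs_V d x : lcs d x -> lcs d x^-1.
Proof. by case: d => [|[|d]] //; apply: gen_V. Qed.
Lemma lcs_Rr d x y : lcs d y -> lcs d.+1 [~ x, y].
Proof. by case: d => [|d] // hy; apply: gen_in; exists x, y. Qed.
Lemma lcs_Rl d x y : lcs d x -> lcs d.+1 [~ x, y].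
Proof. by move=> hx; rewrite -invgR; apply/lcs_V/lcs_Rr. Qed.

Lemma lcs_J d x y : lcs d x -> lcs d (x ^ y).
Proof.
elim: d x y => [|[|d] IH] // x y; elim=> {x}.
- move=> x [a [b [hb ->]]]; rewrite conjRg; apply: gen_in.
  by exists (a ^ y), (b ^ y); split=> //; apply: IH.
- by rewrite conj1g; apply: gen_1.
- by move=> x x' _ h _ h'; rewrite conjMg; apply: gen_M.
- by move=> x _ h; rewrite conjVg; apply: gen_V.
Qed.

Lemma lcs_S d x : lcs d.+1 x -> lcs d x.
Proof.
case: d => [|d] //; elim=> {x}.
- move=> x [a [b [hb ->]]]; rewrite commgEr.
  by apply: lcs_M => //; apply/lcs_J/lcs_V.
- exact: lcs_1.
- by move=> x y _ hx _ hy; apply: lcs_M.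
- by move=> x _ hx; apply: lcs_V.
Qed.

Lemma Hall_Witt x y z :
  [~ x, y^-1, z] ^ y * [~ y, z^-1, x] ^ z * [~ z, x^-1, y] ^ x = 1.
Proof. by rewrite /commg /conjg !gnorm. Qed.

Lemma lcs_R p q x y : lcs p x -> lcs q y -> lcs (p + q) [~ x, y].
Proof.
elim: p q x y => [|[|p] IH] q x y.
- by move=> _ hy; rewrite add0n; apply/lcs_S/lcs_Rr.
- by move=> _ hy; rewrite add1n; apply: lcs_Rr.
move=> hx hy; elim: hx => {x}.
- move=> x [a [b [hb ->]]].
  have := Hall_Witt a b^-1 y; rewrite invgK => hw.
  have h2 : lcs (p.+2 + q) ([~ b^-1, y^-1, a] ^ y).
    by apply/lcs_J; rewrite addSn; apply/lcs_Rl/IH; apply: lcs_V.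
  have h3 : lcs (p.+2 + q) ([~ y, a^-1, b^-1] ^ a).
    apply/lcs_J; rewrite addSnnS -invgR.
    by apply/lcs_V/IH; [apply: lcs_V | apply: lcs_Rl].
  rewrite -(conjgKV b [~ a, b, y]); apply: lcs_J.
  have -> : [~ a, b, y] ^ b^-1 =
      ([~ b^-1, y^-1, a] ^ y * [~ y, a^-1, b^-1] ^ a)^-1.
    by apply: divg1_eq; rewrite invgK mulgA.
  by apply/lcs_V/lcs_M.
- by rewrite comm1g; apply: lcs_1.
- move=> x x' _ h _ h'; have -> : [~ x * x', y] = [~ x, y] ^ x' * [~ x', y].
    by rewrite /commg /conjg !gnorm.
  by apply: lcs_M => //; apply: lcs_J.
- move=> x _ h; have -> : [~ x^-1, y] = ([~ x, y]^-1) ^ (x^-1).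
    by rewrite /commg /conjg !gnorm.
  by apply/lcs_J/lcs_V.
Qed.

Definition lcs_sub d := {x : G | `[< lcs d x >]}.
HB.instance Definition _ d := Choice.on (lcs_sub d).

Definition gr_eq d (x y : lcs_sub d) : Prop := lcs d.+1 ((val x)^-1 * val y).

Lemma gr_eq_equiv d : is_equiv (@gr_eq d).
Proof.
split=> [x|x y|x y z]; rewrite /gr_eq.
- by rewrite mulVg; apply: lcs_1.
- by move=> h; rewrite -[X in lcs _ X]invgK invgM invgK; apply: lcs_V.
- by move=> h h'; have := lcs_M h h'; rewrite !gnorm.
Qed.

Definition gr d : Type := quot (@gr_eq_equiv d).
HB.instance Definition _ d := Choice.on (gr d).

Fact lcs_sub1_subproof d : `[< lcs d 1 >].
Proof. by apply/asboolP/lcs_1. Qed.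

(* The class of x in gr d; junk value 0 unless x lies in lcs d. *)
Definition grcls d x : gr d :=
  qcls (@gr_eq_equiv d) (insubd (exist _ 1 (lcs_sub1_subproof d)) x).
Definition grrep d (a : gr d) : G := val (qrep a).

Lemma grrepP d (a : gr d) : lcs d (grrep a).
Proof. exact/asboolP/(valP (qrep a)). Qed.

Lemma grrepK d (a : gr d) : grcls d (grrep a) = a.
Proof. by rewrite /grcls /grrep valKd qrepK. Qed.

Lemma grclsP d x y : lcs d x -> lcs d y ->
  grcls d x = grcls d y <-> lcs d.+1 (x^-1 * y).
Proof.
move=> hx hy; rewrite /grcls; split.
  by move/qclsP; rewrite /gr_eq !insubdK //; apply/asboolP.
by move=> h; apply/qclsP; rewrite /gr_eq !insubdK //; apply/asboolP.
Qed.

Lemma grclsK d x : lcs d x -> lcs d.+1 ((grrep (grcls d x))^-1 * x).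
Proof. by move=> hx; apply/(grclsP (grrepP _) hx); rewrite grrepK. Qed.

Lemma grcls_ind d (P : gr d -> Prop) :
  (forall x, lcs d x -> P (grcls d x)) -> forall a, P a.
Proof. by move=> h a; rewrite -(grrepK a); apply/h/grrepP. Qed.

Definition gr_add d (a b : gr d) : gr d := grcls d (grrep a * grrep b).
Definition gr_opp d (a : gr d) : gr d := grcls d (grrep a)^-1.

Lemma gr_addE d x y : lcs d x -> lcs d y ->
  gr_add (grcls d x) (grcls d y) = grcls d (x * y).
Proof.
move=> hx hy; apply/grclsP; try by apply: lcs_M => //; apply: grrepP.
have kx := grclsK hx; have ky := grclsK hy.
set x' := grrep _ in kx *; set y' := grrep _ in ky *.
have -> : (x' * y')^-1 * (x * y) = ((x'^-1 * x) ^ y') * (y'^-1 * y).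
  by rewrite /conjg !gnorm.
by apply: lcs_M => //; apply: lcs_J.
Qed.

Lemma gr_oppE d x : lcs d x -> gr_opp (grcls d x) = grcls d x^-1.
Proof.
move=> hx; apply/grclsP; try by apply: lcs_V => //; apply: grrepP.
have kx := grclsK hx; set x' := grrep _ in kx *.
have -> : (x'^-1)^-1 * x^-1 = ((x'^-1 * x)^-1) ^ (x'^-1).
  by rewrite /conjg !gnorm.
by apply/lcs_J/lcs_V.
Qed.

Fact gr_addA d : associative (@gr_add d).
Proof.
do 3!elim/grcls_ind=> ? ?; rewrite !gr_addE ?mulgA //; exact: lcs_M.
Qed.
Fact gr_addC d : commutative (@gr_add d).
Proof.
elim/grcls_ind=> x hx; elim/grcls_ind=> y hy; rewrite !gr_addE //.
apply/grclsP; try exact: lcs_M.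
have -> : (x * y)^-1 * (y * x) = [~ y, x] by rewrite /commg /conjg !gnorm.
exact: lcs_Rr.
Qed.
Fact gr_add0 d : left_id (grcls d 1) (@gr_add d).
Proof.
by elim/grcls_ind=> x hx; rewrite gr_addE ?mul1g //; apply: lcs_1.
Qed.
Fact gr_addN d : left_inverse (grcls d 1) (@gr_opp d) (@gr_add d).
Proof.
by elim/grcls_ind=> x hx; rewrite gr_oppE // gr_addE ?mulVg //; apply: lcs_V.
Qed.

HB.instance Definition _ d :=
  GRing.isZmodule.Build (gr d) (@gr_addA d) (@gr_addC d) (@gr_add0 d) (@gr_addN d).

Lemma grcls1 d : grcls d 1 = 0%R. Proof. by []. Qed.
Lemma grclsM d x y : lcs d x -> lcs d y -> grcls d (x * y) = (grcls d x + grcls d y)%R.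
Proof. by move=> hx hy; rewrite -gr_addE. Qed.
Lemma grclsV d x : lcs d x -> grcls d x^-1 = (- grcls d x)%R.
Proof. by move=> hx; rewrite -gr_oppE. Qed.
Lemma grcls_eq0 d x : lcs d x -> grcls d x = 0%R <-> lcs d.+1 x.
Proof.
move=> hx; rewrite -grcls1; split.
  by move/(grclsP hx (lcs_1 d)); rewrite mulg1 => /lcs_V; rewrite invgK.
by move=> h; apply/grclsP => //; [apply: lcs_1 | rewrite mulg1; apply: lcs_V].
Qed.
Lemma grclsJ d x y : lcs d x -> grcls d (x ^ y) = grcls d x.
Proof.
move=> hx; apply/grclsP => //; first exact: lcs_J.
have -> : (x ^ y)^-1 * x = [~ y, x] by rewrite /commg /conjg !gnorm.
exact: lcs_Rr.
Qed.

(* The bracket gr p x gr q -> gr n induced by the group commutator, for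
   n = p + q; zero for any other n. *)
Definition gr_br p q n (a : gr p) (b : gr q) : gr n :=
  if (p + q == n)%N then grcls n [~ grrep a, grrep b] else 0%R.

Lemma gr_brE p q x y : lcs p x -> lcs q y ->
  gr_br (p + q) (grcls p x) (grcls q y) = grcls (p + q) [~ x, y].
Proof.
move=> hx hy; rewrite /gr_br eqxx.
have kx := grclsK hx; have ky := grclsK hy.
have := grrepP (grcls p x); have := grrepP (grcls q y).
set x' := grrep _ in kx *; set y' := grrep _ in ky * => hy' hx'.
have -> : x = x' * (x'^-1 * x) by rewrite mulVKg.
have -> : y = y' * (y'^-1 * y) by rewrite mulVKg.
move: (x'^-1 * x) (y'^-1 * y) kx ky => u v ku kv.
have hu := lcs_S ku; have hv := lcs_S kv.
have -> : [~ x' * u, y' * v] =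
   ([~ x', v] * [~ x', y'] ^ v) ^ u * [~ u, y' * v].
  by rewrite /commg /conjg !gnorm.
have h1 : lcs (p + q).+1 [~ u, y' * v].
  by rewrite -addSn; apply: lcs_R => //; apply: lcs_M.
have h2 : lcs (p + q).+1 [~ x', v] by rewrite -addnS; apply: lcs_R.
have h3 : lcs (p + q) [~ x', y'] by apply: lcs_R.
have h4 : lcs (p + q) ([~ x', y'] ^ v) by apply: lcs_J.
have h5 := lcs_S h2.
have h6 := lcs_M h5 h4; have h7 := lcs_J u h6; have h8 := lcs_S h1.
rewrite (grclsM h7 h8) (grclsJ u h6) (grclsM h5 h4) (grclsJ v h3).
by move/(grcls_eq0 h5): h2 => ->; move/(grcls_eq0 h8): h1 => ->; rewrite add0r addr0.
Qed.

Fact gr_brDl p q n (a a' : gr p) (b : gr q) :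
  gr_br n (a + a')%R b = (gr_br n a b + gr_br n a' b)%R.
Proof.
have [<-|ne] := eqVneq (p + q)%N n; last by rewrite /gr_br (negbTE ne) addr0.
elim/grcls_ind: a => x hx; elim/grcls_ind: a' => x' hx'.
elim/grcls_ind: b => y hy; rewrite -grclsM // !gr_brE //; last exact: lcs_M.
have -> : [~ x * x', y] = [~ x, y] ^ x' * [~ x', y].
  by rewrite /commg /conjg !gnorm.
have h1 : lcs (p + q) [~ x, y] by apply: lcs_R.
have h2 : lcs (p + q) [~ x', y] by apply: lcs_R.
by rewrite (grclsM (lcs_J x' h1) h2) (grclsJ x' h1).
Qed.

Fact gr_brC p q n (a : gr p) (b : gr q) : gr_br n a b = (- gr_br n b a)%R.
Proof.
have [<-|ne] := eqVneq (p + q)%N n; last first.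
  by rewrite /gr_br (negbTE ne) addnC (negbTE ne) oppr0.
elim/grcls_ind: a => x hx; elim/grcls_ind: b => y hy.
rewrite gr_brE // addnC gr_brE // -grclsV ?invgR //; exact: lcs_R.
Qed.

Fact gr_brDr p q n (a : gr p) (b b' : gr q) :
  gr_br n a (b + b')%R = (gr_br n a b + gr_br n a b')%R.
Proof. by rewrite gr_brC gr_brDl opprD -!gr_brC. Qed.

Lemma gr_br0r p q n (a : gr p) : gr_br n a (0%R : gr q) = 0%R.
Proof. by apply: (addrI (gr_br n a (0%R : gr q))); rewrite -gr_brDr !addr0. Qed.
Lemma gr_brNr p q n (a : gr p) (b : gr q) : gr_br n a (- b)%R = (- gr_br n a b)%R.
Proof. by apply/eqP; rewrite -addr_eq0 -gr_brDr addNr gr_br0r. Qed.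

Lemma gr_jacobi p q r n (a : gr p) (b : gr q) (c : gr r) : (p + q + r)%N = n ->
  (gr_br n a (gr_br (q + r) b c) + gr_br n b (gr_br (r + p) c a)
     + gr_br n c (gr_br (p + q) a b) = 0)%R.
Proof.
move=> en.
elim/grcls_ind: a => x hx; elim/grcls_ind: b => y hy; elim/grcls_ind: c => z hz.
have hxV := lcs_V hx; have hyV := lcs_V hy; have hzV := lcs_V hz.
have step p1 p2 p3 (u v w : G) : (p1 + p2 + p3)%N = n ->
    lcs p1 u -> lcs p2 v -> lcs p3 w ->
    lcs n [~ u, v^-1, w] /\
    grcls n [~ u, v^-1, w] =
      gr_br n (grcls p3 w) (gr_br (p1 + p2) (grcls p1 u) (grcls p2 v)).
  move=> e hu hv hw; have hvV := lcs_V hv.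
  have huv := lcs_R hu hvV; split; first by rewrite -e; apply: lcs_R.
  rewrite -{}e.
  rewrite -(gr_brE huv hw) gr_brC -(gr_brE hu hvV) grclsV //.
  by rewrite !gr_brNr opprK.
have [h1 e1] := step p q r x y z en hx hy hz.
have [h2 e2] := step q r p y z x (etrans (etrans (addnC _ _) (addnA _ _ _)) en) hy hz hx.
have [h3 e3] := step r p q z x y (etrans (etrans (esym (addnA _ _ _)) (addnC _ _)) en) hz hx hy.
have /(congr1 (grcls n)) := Hall_Witt x y z.
rewrite (grclsM (lcs_M (lcs_J y h1) (lcs_J z h2)) (lcs_J x h3)).
rewrite (grclsM (lcs_J y h1) (lcs_J z h2)) (grclsJ y h1) (grclsJ z h2) (grclsJ x h3).
by rewrite e1 e2 e3 grcls1 => <-; rewrite addrC addrA.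
Qed.

End LowerCentralSeries.

(* The Lie algebra of families (a_d)_d with a_d in gr d (x) Q.  It contains the
   direct sum of the gr d (x) Q as a Lie subalgebra and has the same
   homogeneous components, which is all that the kernels I_d see; compare
   lie_canon_graded. *)
Section AssociatedGraded.
Variable G : groupType.

Definition grQ (d : nat) : lmodType rat := tensQ (gr G d).

Definition assoc_gr : Type := forall d, grQ d.
HB.instance Definition _ := gen_eqMixin assoc_gr.
HB.instance Definition _ := gen_choiceMixin assoc_gr.
Implicit Types a b c : assoc_gr.

Lemma assoc_grP a b : (forall d, a d = b d) -> a = b.
Proof. exact: functional_extensionality_dep. Qed.

Definition agr_zero : assoc_gr := fun _ => 0.
Definition agr_add a b : assoc_gr := fun d => a d + b d.
Definition agr_opp a : assoc_gr := fun d => - a d.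
Definition agr_scale (s : rat) a : assoc_gr := fun d => s *: a d.

Fact agr_addA : associative agr_add.
Proof. by move=> a b c; apply: assoc_grP => d; apply: addrA. Qed.
Fact agr_addC : commutative agr_add.
Proof. by move=> a b; apply: assoc_grP => d; apply: addrC. Qed.
Fact agr_add0 : left_id agr_zero agr_add.
Proof. by move=> a; apply: assoc_grP => d; apply: add0r. Qed.
Fact agr_addN : left_inverse agr_zero agr_opp agr_add.
Proof. by move=> a; apply: assoc_grP => d; apply: addNr. Qed.
HB.instance Definition _ :=
  GRing.isZmodule.Build assoc_gr agr_addA agr_addC agr_add0 agr_addN.

Fact agr_scaleA s t a : agr_scale s (agr_scale t a) = agr_scale (s * t) a.
Proof. by apply: assoc_grP => d; apply: scalerA. Qed.
Fact agr_scale1 : left_id 1 agr_scale.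
Proof. by move=> a; apply: assoc_grP => d; apply: scale1r. Qed.
Fact agr_scaleDr : right_distributive agr_scale +%R.
Proof. by move=> s a b; apply: assoc_grP => d; apply: scalerDr. Qed.
Fact agr_scaleDl a : {morph agr_scale^~ a : s t / s + t}.
Proof. by move=> s t; apply: assoc_grP => d; apply: scalerDl. Qed.
HB.instance Definition _ := GRing.Zmodule_isLmodule.Build rat assoc_gr
  agr_scaleA agr_scale1 agr_scaleDr agr_scaleDl.

Lemma agrD a b d : (a + b) d = a d + b d. Proof. by []. Qed.
Lemma agrZ s a d : (s *: a) d = s *: a d. Proof. by []. Qed.
Lemma agrN a d : (- a) d = - a d. Proof. by []. Qed.
Lemma agr0 d : (0 : assoc_gr) d = 0. Proof. by []. Qed.

Definition grQ_br p q n : grQ p -> grQ q -> grQ n := tens2 (@gr_br G p q n).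

Lemma grQ_brDl p q n (x x' : grQ p) (y : grQ q) :
  grQ_br n (x + x') y = grQ_br n x y + grQ_br n x' y.
Proof. by apply: tens2Dl; [apply: gr_brDl | apply: gr_brDr]. Qed.
Lemma grQ_brDr p q n (x : grQ p) (y y' : grQ q) :
  grQ_br n x (y + y') = grQ_br n x y + grQ_br n x y'.
Proof. by apply: tens2Dr; [apply: gr_brDl | apply: gr_brDr]. Qed.
Lemma grQ_brZl p q n s (x : grQ p) (y : grQ q) :
  grQ_br n (s *: x) y = s *: grQ_br n x y.
Proof. by apply: tens2Zl; [apply: gr_brDl | apply: gr_brDr]. Qed.
Lemma grQ_brZr p q n s (x : grQ p) (y : grQ q) :
  grQ_br n x (s *: y) = s *: grQ_br n x y.
Proof. by apply: tens2Zr; [apply: gr_brDl | apply: gr_brDr]. Qed.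
Lemma grQ_brE p q n (a : gr G p) (b : gr G q) s t :
  grQ_br n (tens a s) (tens b t) = tens (gr_br n a b) (s * t).
Proof. by apply: tens2E; [apply: gr_brDl | apply: gr_brDr]. Qed.
Lemma grQ_brC p q n (x : grQ p) (y : grQ q) : grQ_br n x y = - grQ_br n y x.
Proof.
elim/tens_ind: x => a s; elim/tens_ind: y => b t.
by rewrite !grQ_brE gr_brC mulrC tensN.
Qed.
Lemma grQ_br0 p q n (x : grQ p) (y : grQ q) : (p + q)%N != n -> grQ_br n x y = 0.
Proof.
move=> ne; elim/tens_ind: x => a s; elim/tens_ind: y => b t.
by rewrite grQ_brE /gr_br (negbTE ne) tens0.
Qed.
Lemma grQ_br0l p q n (y : grQ q) : grQ_br n (0 : grQ p) y = 0.
Proof. by apply: (addrI (grQ_br n (0 : grQ p) y)); rewrite -grQ_brDl !addr0. Qed.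
Lemma grQ_br0r p q n (x : grQ p) : grQ_br n x (0 : grQ q) = 0.
Proof. by rewrite grQ_brC grQ_br0l oppr0. Qed.
Lemma grQ_jacobi p q r n (x : grQ p) (y : grQ q) (z : grQ r) :
  (p + q + r)%N = n ->
  grQ_br n x (grQ_br (q + r) y z) + grQ_br n y (grQ_br (r + p) z x)
    + grQ_br n z (grQ_br (p + q) x y) = 0.
Proof.
elim/tens_ind: x => a s; elim/tens_ind: y => b t; elim/tens_ind: z => c u e.
rewrite (grQ_brE _ b c) (grQ_brE _ c a) (grQ_brE _ a b).
rewrite (grQ_brE _ a) (grQ_brE _ b) (grQ_brE _ c) (_ : t * (u * s) = s * (t * u)); last by ring.
by rewrite (_ : u * (s * t) = s * (t * u)) -?tens_addl ?gr_jacobi ?tens0 //; ring.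
Qed.

Definition agr_lie a b : assoc_gr := fun n =>
  \sum_(p < n.+1) \sum_(q < n.+1) grQ_br n (a p) (b q).

Lemma agr_lieE N a b n : (n < N)%N ->
  agr_lie a b n = \sum_(p < N) \sum_(q < N) grQ_br n (a p) (b q).
Proof.
move=> nN; rewrite /agr_lie.
rewrite (big_ord_widen N (fun p => \sum_(q < n.+1) grQ_br n (a p) (b q))) //.
rewrite big_mkcond /=; apply: eq_bigr => p _; case: ifP => [_|/negbT pn].
  rewrite (big_ord_widen N (fun q => grQ_br n (a p) (b q))) //.
  rewrite big_mkcond /=; apply: eq_bigr => q _; case: ifP => [//|/negbT qn].
  rewrite grQ_br0 //; apply: contra qn => /eqP <-.
  by rewrite ltnS leq_addl.
rewrite big1 // => q _; rewrite grQ_br0 //; apply: contra pn => /eqP <-.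
by rewrite ltnS leq_addr.
Qed.

Fact agr_lieDl a a' b : agr_lie (a + a') b = agr_lie a b + agr_lie a' b.
Proof.
apply: assoc_grP => n; rewrite agrD /agr_lie -big_split; apply: eq_bigr => p _.
by rewrite -big_split; apply: eq_bigr => q _; rewrite agrD grQ_brDl.
Qed.
Fact agr_lieZl s a b : agr_lie (s *: a) b = s *: agr_lie a b.
Proof.
apply: assoc_grP => n; rewrite agrZ /agr_lie scaler_sumr; apply: eq_bigr => p _.
by rewrite scaler_sumr; apply: eq_bigr => q _; rewrite agrZ grQ_brZl.
Qed.
Fact agr_lieC a b : agr_lie a b = - agr_lie b a.
Proof.
apply: assoc_grP => n; rewrite agrN /agr_lie exchange_big.
rewrite -sumrN; apply: eq_bigr => p _; rewrite -sumrN; apply: eq_bigr => q _.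
exact: grQ_brC.
Qed.
Fact agr_lieDr a b b' : agr_lie a (b + b') = agr_lie a b + agr_lie a b'.
Proof. by rewrite agr_lieC agr_lieDl opprD -!agr_lieC. Qed.
Fact agr_lieZr s a b : agr_lie a (s *: b) = s *: agr_lie a b.
Proof. by rewrite agr_lieC agr_lieZl -scalerN -agr_lieC. Qed.
Fact agr_liexx a : agr_lie a a = 0.
Proof.
have /eqP := agr_lieC a a; rewrite -addr_eq0 -mulr2n -scaler_nat scaler_eq0.
by case/orP=> // /eqP.
Qed.

Lemma agr_lie2E a b c n : agr_lie a (agr_lie b c) n =
  \sum_(p < n.+1) \sum_(q < n.+1) \sum_(r < n.+1) \sum_(m < n.+1)
    grQ_br n (a p) (grQ_br m (b q) (c r)).
Proof.
rewrite {1}/agr_lie; apply: eq_bigr => p _.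
have sumr (x : grQ p) I (s : seq I) m (F : I -> grQ m) :
    grQ_br n x (\sum_(i <- s) F i) = \sum_(i <- s) grQ_br n x (F i).
  by elim: s => [|i s IH]; rewrite ?big_nil ?grQ_br0r // !big_cons grQ_brDr IH.
transitivity (\sum_(m < n.+1) \sum_(q < n.+1) \sum_(r < n.+1)
    grQ_br n (a p) (grQ_br m (b q) (c r))).
  apply: eq_bigr => m _; rewrite (agr_lieE _ _ (ltn_ord m)) sumr.
  by apply: eq_bigr => q _; rewrite sumr.
by rewrite exchange_big; apply: eq_bigr => q _; rewrite exchange_big.
Qed.

Fact agr_jacobi a b c : agr_lie a (agr_lie b c) + agr_lie b (agr_lie c a)
  + agr_lie c (agr_lie a b) = 0.
Proof.
apply: assoc_grP => n; rewrite !agrD !agr_lie2E agr0.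
have rot (V : nmodType) (F : 'I_n.+1 -> 'I_n.+1 -> 'I_n.+1 -> V) :
    \sum_p \sum_q \sum_r F p q r = \sum_r \sum_p \sum_q F p q r.
  transitivity (\sum_p \sum_r \sum_q F p q r); last exact: exchange_big.
  by apply: eq_bigr => p _; exact: exchange_big.
rewrite [X in _ + X + _]rot [X in _ + _ + X]rot [X in _ + _ + X]rot.
rewrite -!big_split big1 // => p _; rewrite -!big_split big1 // => q _.
rewrite -!big_split big1 // => r _ /=.
have E i j k (x : grQ i) (y : grQ j) (z : grQ k) :
    \sum_(m < n.+1) grQ_br n x (grQ_br m y z) =
      if (i + j + k)%N == n then grQ_br n x (grQ_br (j + k) y z) else 0.
  case: eqP => [e|/eqP ne]; last first.
    rewrite big1 // => m _; have [jk|jk] := eqVneq (j + k)%N m.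
      by rewrite grQ_br0 // -jk addnA.
    by rewrite (grQ_br0 _ _ jk) grQ_br0r.
  have jk : (j + k < n.+1)%N by rewrite -e -addnA ltnS leq_addl.
  rewrite (bigD1 (Ordinal jk)) //= big1 ?addr0 // => m ne.
  by rewrite (@grQ_br0 _ _ m) ?grQ_br0r //; apply: contraNneq ne => e'; apply/eqP/val_inj.
rewrite !E (_ : (q + r + p = p + q + r)%N); last by rewrite addnC addnA.
rewrite (_ : (r + p + q = p + q + r)%N); last by rewrite -addnA addnC.
by case: eqP => [e|_]; rewrite ?addr0 // grQ_jacobi.
Qed.

HB.instance Definition _ := Lmodule_isLie.Build rat assoc_gr
  agr_lieDl agr_lieDr agr_lieZl agr_lieZr agr_liexx agr_jacobi.

Definition agr_in1 (x : grQ 1) : assoc_gr :=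
  fun n => if n is 1 then x else 0.

Fact agr_in1_linear : linear agr_in1.
Proof.
by move=> s x y; apply: assoc_grP => -[|[|d]] //; rewrite agrD agrZ scaler0 addr0.
Qed.
HB.instance Definition _ :=
  GRing.isLinear.Build rat (grQ 1) assoc_gr _ agr_in1 agr_in1_linear.

End AssociatedGraded.
Section Graphs.
Variables (V : finType) (e : rel V).

Definition induced (A : {set V}) : rel V :=
  fun x y => [&& x \in A, y \in A & e x y].

Definition connected_on (A : {set V}) : bool :=
  [forall x in A, forall y in A, connect (induced A) x y].

Definition biconnected : bool :=
  [&& (2 < #|V|)%N, connected_on [set: V] & [forall v, connected_on [set~ v]]].

Definition separator (S : {set V}) : bool := ~~ connected_on (~: S).

Definition minimal_separator (S : {set V}) : bool := minset separator S.

(* Words in the letters v = (v, false) and v^-1 = (v, true). *)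
Definition word := seq (V * bool).

Inductive raag_eq : word -> word -> Prop :=
| RErefl w : raag_eq w w
| REsym w w' : raag_eq w w' -> raag_eq w' w
| REtrans w w' w'' : raag_eq w w' -> raag_eq w' w'' -> raag_eq w w''
| REcat w1 w1' w2 w2' :
    raag_eq w1 w1' -> raag_eq w2 w2' -> raag_eq (w1 ++ w2) (w1' ++ w2')
| REcancel v b : raag_eq [:: (v, b); (v, ~~ b)] [::]
| REcomm u v : e u v ->
    raag_eq [:: (u, false); (v, false)] [:: (v, false); (u, false)].

Lemma raag_eq_equiv : is_equiv raag_eq.
Proof. by split; [apply: RErefl | apply: REsym | apply: REtrans]. Qed.

Definition raag : Type := quot raag_eq_equiv.
HB.instance Definition _ := Choice.on raag.

Definition raag_cls (w : word) : raag := qcls raag_eq_equiv w.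

Lemma raag_clsP w w' : raag_cls w = raag_cls w' <-> raag_eq w w'.
Proof. exact: qclsP. Qed.
Lemma raag_ind (P : raag -> Prop) : (forall w, P (raag_cls w)) -> forall x, P x.
Proof. by move=> h x; rewrite -[x]qrepK; apply: h. Qed.

Definition inv_word (w : word) : word := rev [seq (l.1, ~~ l.2) | l <- w].

Lemma inv_word_cat w w' : inv_word (w ++ w') = inv_word w' ++ inv_word w.
Proof. by rewrite /inv_word map_cat rev_cat. Qed.
Lemma inv_wordK : involutive inv_word.
Proof.
move=> w; rewrite /inv_word map_rev revK -map_comp -[RHS]map_id.
by apply: eq_map => -[v b] /=; rewrite negbK.
Qed.
Lemma inv_word_mulr w : raag_eq (w ++ inv_word w) [::].
Proof.
elim: w => [|[v b] w IH]; first exact: RErefl.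
rewrite -[_ :: w]cat1s inv_word_cat -catA (catA w).
apply: REtrans (REcancel v b); rewrite -[[:: _; _]]/([:: (v, b)] ++ [::] ++ [:: (v, ~~ b)]).
by apply/REcat/REcat; rewrite ?cats0 //; apply: RErefl.
Qed.
Lemma inv_word_mull w : raag_eq (inv_word w ++ w) [::].
Proof. by rewrite -{2}[w]inv_wordK; apply: inv_word_mulr. Qed.

Lemma inv_word_eq w w' : raag_eq w w' -> raag_eq (inv_word w) (inv_word w').
Proof.
move=> h; apply: (@REtrans _ (inv_word w ++ (w' ++ inv_word w'))).
  rewrite -{1}[inv_word w]cats0; apply: REcat; first exact: RErefl.
  exact/REsym/inv_word_mulr.
rewrite catA -{2}[inv_word w']cat0s; apply: REcat; last exact: RErefl.
apply: REtrans (inv_word_mull w); apply: REcat; [exact: RErefl | exact: REsym].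
Qed.

Definition raag_mul (x y : raag) : raag := raag_cls (qrep x ++ qrep y).
Definition raag_inv (x : raag) : raag := raag_cls (inv_word (qrep x)).
Definition raag_one : raag := raag_cls [::].

Lemma raag_mulE w w' : raag_mul (raag_cls w) (raag_cls w') = raag_cls (w ++ w').
Proof. by apply/raag_clsP/REcat; apply: qrepP. Qed.
Lemma raag_invE w : raag_inv (raag_cls w) = raag_cls (inv_word w).
Proof. by apply/raag_clsP/inv_word_eq; apply: qrepP. Qed.

Fact raag_mulA : associative raag_mul.
Proof. by do 3!elim/raag_ind=> ?; rewrite !raag_mulE catA. Qed.
Fact raag_mul1 : left_id raag_one raag_mul.
Proof. by elim/raag_ind=> ?; rewrite raag_mulE. Qed.
Fact raag_mulr1 : right_id raag_one raag_mul.
Proof. by elim/raag_ind=> ?; rewrite raag_mulE cats0. Qed.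
Fact raag_mulV : left_inverse raag_one raag_inv raag_mul.
Proof.
by elim/raag_ind=> ?; rewrite raag_invE raag_mulE; apply/raag_clsP/inv_word_mull.
Qed.
Fact raag_mulrV : right_inverse raag_one raag_inv raag_mul.
Proof.
by elim/raag_ind=> ?; rewrite raag_invE raag_mulE; apply/raag_clsP/inv_word_mulr.
Qed.
HB.instance Definition _ :=
  isGroup.Build raag raag_mulA raag_mul1 raag_mulr1 raag_mulV raag_mulrV.

Definition raag_gen (v : V) : raag := raag_cls [:: (v, false)].

(* The homomorphism to an abelian group sending each generator v to f v. *)
Section AbelianHom.
Variables (M : zmodType) (f : V -> M).

Definition word_val (w : word) : M :=
  \sum_(l <- w) if l.2 then - f l.1 else f l.1.

Definition raag_hom (x : raag) : M := word_val (qrep x).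

Lemma word_val_cat w w' : word_val (w ++ w') = word_val w + word_val w'.
Proof. exact: big_cat. Qed.

Lemma word_val_eq w w' : raag_eq w w' -> word_val w = word_val w'.
Proof.
elim=> //.
- by move=> ? ? ? _ -> _ ->.
- by move=> ? ? ? ? _ h _ h'; rewrite !word_val_cat h h'.
- move=> v b; rewrite /word_val !big_cons !big_nil /= addr0.
  by case: b; rewrite ?addNr ?addrN.
- by move=> u v _; rewrite /word_val !big_cons !big_nil /= !addr0 addrC.
Qed.

Lemma raag_homE w : raag_hom (raag_cls w) = word_val w.
Proof. by apply: word_val_eq; apply: qrepP. Qed.
Lemma raag_hom_gen v : raag_hom (raag_gen v) = f v.
Proof. by rewrite raag_homE /word_val big_seq1. Qed.
Lemma raag_homM x y : raag_hom (x * y)%g = raag_hom x + raag_hom y.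
Proof.
elim/raag_ind: x => w; elim/raag_ind: y => w'.
by rewrite [(_ * _)%g]raag_mulE !raag_homE word_val_cat.
Qed.
Lemma raag_hom1 : raag_hom 1%g = 0.
Proof. by apply: (addrI (raag_hom 1%g)); rewrite -raag_homM mulg1 addr0. Qed.
Lemma raag_homV x : raag_hom x^-1%g = - raag_hom x.
Proof. by apply/eqP; rewrite -addr_eq0 -raag_homM mulVg raag_hom1. Qed.

End AbelianHom.

Definition chi : raag -> int := raag_hom (fun _ => 1).

Definition ker_chi : pred raag := fun x => chi x == 0.

Fact ker_chi_closed : group_closed ker_chi.
Proof.
split=> [|x y]; rewrite -!topredE /= /ker_chi /chi ?raag_hom1 //.
by move=> /eqP hx /eqP hy; rewrite raag_homM raag_homV hx hy subr0.
Qed.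

Definition bb : Type := {x : raag | ker_chi x}.
HB.instance Definition _ := SubChoice.on bb.
HB.instance Definition _ := SubChoice_isSubGroup.Build raag ker_chi bb ker_chi_closed.

Fact bb_diff_subproof u v : ker_chi (raag_gen u / raag_gen v)%g.
Proof. by rewrite /ker_chi /chi raag_homM raag_homV !raag_hom_gen subrr. Qed.
Definition bb_diff u v : bb := exist (fun x => ker_chi x) _ (bb_diff_subproof u v).

End Graphs.

Section Homology.
Variable V : finType.

Definition QV : vectType rat := {ffun V -> rat^o}.

Definition std (v : V) : QV := [ffun w => (w == v)%:R].

Definition eps_fun (x : QV) : rat^o := \sum_v x v.
Fact eps_fun_linear : linear eps_fun.
Proof.
move=> a x y; rewrite /eps_fun scaler_sumr -big_split.
by apply: eq_bigr => v _; rewrite !ffunE.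
Qed.
HB.instance Definition _ := GRing.isLinear.Build rat QV rat^o _ eps_fun eps_fun_linear.

Definition eps : 'Hom(QV, rat^o) := linfun eps_fun.

Definition LQ : vectType rat := subvs_of (lker eps).

(* W_Q, realized as the dual of L_Q. *)
Definition WQ : vectType rat := 'Hom(LQ, rat^o).

Definition L_lattice (x : LQ) : Prop := forall v, (vsval x : QV) v \is a Num.int.

Definition W_lattice (f : WQ) : Prop :=
  forall x : LQ, L_lattice x -> f x \is a Num.int.

Definition preserves_W_lattice (A : 'End(WQ)) : Prop :=
  forall f, W_lattice f -> W_lattice (A f).

Definition std_diff (v w : V) : LQ := vsproj (lker eps) (std v - std w).

Definition D_sep (S : {set V}) : {vspace LQ} :=
  <<[seq std_diff p.1 p.2 | p <- enum (setX S S)]>>%VS.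

(* The endomorphism A^T of L_Q dual to A; characterized by dual_endE. *)
Definition dual_end_fun (A : 'End(WQ)) (x : LQ) : LQ :=
  \sum_(i < \dim {:LQ}) (A (linfun (coord (vbasis {:LQ}) i : LQ -> rat^o)) x : rat)
           *: (vbasis {:LQ})`_i.
Fact dual_end_linear A : linear (dual_end_fun A).
Proof.
move=> a x y; rewrite /dual_end_fun scaler_sumr -big_split; apply: eq_bigr => i _.
by rewrite linearP scalerDl scalerA.
Qed.
HB.instance Definition _ A :=
  GRing.isLinear.Build rat LQ LQ _ (dual_end_fun A) (dual_end_linear A).
Definition dual_end (A : 'End(WQ)) : 'End(LQ) := linfun (dual_end_fun A).

Lemma dual_endE A (f : WQ) x : f (dual_end A x) = A f x.
Proof.
rewrite lfunE /= /dual_end_fun linear_sum /=.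
have {2}-> : f = \sum_(i < \dim {:LQ}) (f (vbasis {:LQ})`_i : rat)
                   *: (linfun (coord (vbasis {:LQ}) i : LQ -> rat^o) : WQ).
  apply/lfunP => y; rewrite sum_lfunE {1}(coord_vbasis (memvf y)) linear_sum.
  apply: eq_bigr => i _; rewrite linearZ scale_lfunE lfunE /=.
  by rewrite [LHS]mulrC.
rewrite linear_sum sum_lfunE; apply: eq_bigr => i _.
by rewrite !linearZ /= scale_lfunE [LHS]mulrC.
Qed.

End Homology.

Section Main.
Variables (V : finType) (e : rel V).

Local Notation H := (bb e).

(* The map H -> L_Q inducing the identification of H_1(H; Z) with ker eps. *)
Definition exponents (h : H) : QV V := raag_hom (@std V) (val h).

Lemma exponents_ker h : exponents h \in lker (eps V).
Proof.
rewrite memv_ker lfunE /= /exponents.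
have E (x : raag e) : eps_fun (raag_hom (@std V) x) = (chi x)%:~R.
  elim/raag_ind: x => w; rewrite /chi !raag_homE.
  elim: w => [|[v b] w IH]; first by rewrite /word_val !big_nil linear0.
  rewrite -cat1s !word_val_cat linearD /= IH intrD; congr (_ + _).
  rewrite /word_val !big_seq1 /=.
  have es : eps_fun (std v) = 1.
    rewrite /eps_fun (bigD1 v) //= ffunE eqxx big1 ?addr0 // => w' ne.
    by rewrite ffunE (negbTE ne).
  by case: b; rewrite ?linearN /= es.
by rewrite E; have /eqP -> := valP h.
Qed.

Definition ab_class (h : H) : LQ V := vsproj (lker (eps V)) (exponents h).

Lemma ab_classE h : vsval (ab_class h) = exponents h.
Proof. exact: vsprojK (exponents_ker h). Qed.

(* The inverse identification L_Q -> H_1(H; Q) = gr_1 (x) Q.  The base vertex is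
   immaterial because the coordinates of x sum to zero; see H1_incl_std_diff. *)
Definition H1_incl (x : LQ V) : grQ H 1 :=
  if [pick v : V] is Some v0 then
    \sum_u ((vsval x : QV V) u : rat) *: tens (grcls 1 (bb_diff e u v0)) 1
  else 0.

Fact H1_incl_linear : linear H1_incl.
Proof.
move=> a x y; rewrite /H1_incl; case: pickP => [v0 _|_]; last by rewrite scaler0 addr0.
rewrite scaler_sumr -big_split; apply: eq_bigr => u _ /=.
by rewrite !ffunE scalerDl scalerA.
Qed.
HB.instance Definition _ :=
  GRing.isLinear.Build rat (LQ V) (grQ H 1) _ H1_incl H1_incl_linear.

Lemma std_diffE (u v : V) : vsval (std_diff u v) = std u - std v.
Proof.
apply: vsprojK; rewrite memv_ker lfunE /= linearB /= /eps_fun.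
have es (w : V) : \sum_x std w x = 1 :> rat.
  rewrite (bigD1 w) //= ffunE eqxx big1 ?addr0 // => w' ne.
  by rewrite ffunE (negbTE ne).
by rewrite !es subrr.
Qed.

Lemma H1_incl_std_diff u v :
  H1_incl (std_diff u v) = tens (grcls 1 (bb_diff e u v)) 1.
Proof.
rewrite /H1_incl; case: pickP => [v0 _|/(_ v)] //.
have sum_std w : \sum_x (std w x : rat) *: tens (grcls 1 (bb_diff e x v0)) 1
    = tens (grcls 1 (bb_diff e w v0)) 1.
  rewrite (bigD1 w) //= ffunE eqxx scale1r big1 ?addr0 // => x ne.
  by rewrite ffunE (negbTE ne) scale0r.
have E w : (std u - std v) w = (std u w : rat) - std v w by rewrite !ffunE.
rewrite std_diffE; under eq_bigr do rewrite E scalerBl.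
rewrite sumrB !sum_std -tensN -tens_addl -grclsV // -grclsM //.
congr (tens (grcls 1 _) 1); apply: val_inj.
by rewrite gmulfM gmulfV /= !gnorm.
Qed.

(* The canonical Lie algebra map extending the identification in degree 1. *)
Definition lie_canon : freeLie (LQ V) -> assoc_gr H :=
  freeLie_lift (@agr_in1 H \o H1_incl).

Fact lie_canon_linear : linear lie_canon.
Proof. exact: linearP. Qed.
HB.instance Definition _ :=
  GRing.isLinear.Build rat (freeLie (LQ V)) (assoc_gr H) _ lie_canon lie_canon_linear.
Lemma lie_canonD x y : lie_canon (x + y) = lie_canon x + lie_canon y.
Proof. exact: linearD. Qed.
Lemma lie_canonZ a x : lie_canon (a *: x) = a *: lie_canon x.
Proof. exact: linearZ. Qed.
Lemma lie_canon_var u : lie_canon (fl_var u) = agr_in1 (H1_incl u).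
Proof. exact: freeLie_lift_var. Qed.
Lemma lie_canon_lie x y : lie_canon (lie x y) = lie (lie_canon x) (lie_canon y).
Proof. exact: freeLie_lift_lie. Qed.

(* lie_canon is graded: it maps degree d to the component gr_d (x) Q. *)
Lemma lie_canon_graded d x n : freeLie_deg d x -> n != d -> lie_canon x n = 0.
Proof.
move=> hx; elim: hx n => {d x}.
- by move=> u [|[|n]] //; rewrite lie_canon_var.
- move=> p q x y _ hx _ hy n ne; rewrite lie_canon_lie.
  rewrite /lie /= /agr_lie big1 // => i _; rewrite big1 // => j _.
  have [ip|ip] := eqVneq (i : nat) p; last by rewrite hx ?grQ_br0l.
  have [jq|jq] := eqVneq (j : nat) q; last by rewrite hy ?grQ_br0r.
  by rewrite grQ_br0 // ip jq eq_sym.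
- by move=> d n _; rewrite linear0.
- by move=> d x y _ hx _ hy n ne; rewrite lie_canonD agrD hx ?hy ?addr0.
- by move=> d a x _ hx n ne; rewrite lie_canonZ agrZ hx ?scaler0.
Qed.

(* I_d, as a predicate on the free Lie algebra. *)
Definition rel_ideal (d : nat) (x : freeLie (LQ V)) : Prop :=
  freeLie_deg d x /\ lie_canon x d = 0.

Definition cubic_component_algebra (A : 'End(WQ V)) : Prop :=
  let X := dual_end A in
  [/\ forall x, rel_ideal 2 x -> rel_ideal 2 (freeLie_der X x),
      forall x, rel_ideal 3 x -> rel_ideal 3 (freeLie_der X x)
    & forall S : {set V}, minimal_separator e S -> (X @: D_sep S <= D_sep S)%VS].

Record bb_aut := BBAut {
  aut_fun :> H -> H;
  aut_inv : H -> H;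
  aut_funM : forall x y, aut_fun (x * y)%g = (aut_fun x * aut_fun y)%g;
  aut_funK : cancel aut_fun aut_inv;
  aut_invK : cancel aut_inv aut_fun
}.

(* The class in H^1(H; Q) = Hom(H, Q) of an element of W_Q. *)
Definition H1_class (f : WQ V) : H -> rat := fun h => f (ab_class h).

Lemma H1_classM f x y : H1_class f (x * y)%g = H1_class f x + H1_class f y.
Proof.
rewrite /H1_class -[RHS]linearD; congr (f _); apply: val_inj.
by rewrite [RHS]linearD /= !ab_classE /exponents gmulfM raag_homM.
Qed.

(* The elements of W_Gamma have classes in H^1(H; Z). *)
Lemma H1_class_int f h : W_lattice f -> H1_class f h \is a Num.int.
Proof.
apply=> v; rewrite ab_classE /exponents; elim/raag_ind: (val h) => w.
rewrite raag_homE /word_val sum_ffunE rpred_sum // => -[u b] _ /=.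
by case: b; rewrite !ffunE ?rpredN natr_int.
Qed.

(* The action rho_W(alpha) = (alpha^-1)^* on H^1. *)
Definition rho_W (alpha : bb_aut) (c : H -> rat) : H -> rat := c \o aut_inv alpha.

End Main.

(* Main.v *)
Require Import Defs.
From mathcomp Require Import all_boot all_order all_algebra.
From HB Require Import structures.
From mathcomp Require Import ring zify boolp.

Set Implicit Arguments.
Unset Strict Implicit.
Unset Printing Implicit Defensive.

Import GRing.Theory Num.Theory.
Local Open Scope ring_scope.

(* Write R = x (x) phi, where phi is an integral function on V modulo constants
   and x is an integral vector in ker eps; then R^2 = 0 says phi(x) = 0, and one
   has to realize y |-> y + phi(y) x by an automorphism of H.

   Constraints on (phi, x).  Fix a vertex o, let D = ad o act on gr(H) and put
   U = u - o.  An edge uv gives [U, V] = D U - D V, so [U + V, [U, V]] equals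
   tau(u) - tau(v) with tau(u) = [U, D U] - D D U, and the sum of these elements
   over the edges of a closed walk lies in I_3.  Apply the derivation extending
   y |-> phi(y) x to such a sum, for walks that pass through a vertex v exactly
   once, and read off one coefficient in a nilpotent quotient of H.  This shows
   that supp x lies in the star of every vertex whose link carries two values of
   phi, and in the union of the stars of u and v for every edge uv with
   phi(u) <> phi(v).

   Realization.  If every edge on which phi jumps has an end whose star contains
   supp x, choose h in H with class x and send the letter v, read at height n, to
   h^(- psi(v) n) v h^(phi(v) + psi(v) n), where psi(v) is the value of phi at a
   neighbour of v.  This respects the commutation relations and restricts to an
   endomorphism of H, invertible with inverse given by (- phi, - psi) as soon as
   h is fixed.  When h is not fixed, the values of phi that move it sit on
   vertices with a common link, and that part of the transvection is a product
   of elementary ones obtained from Euclid's algorithm.  If some jump edge uv has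
   no such end, then phi takes only the values phi(u) and phi(v) on supp x, and
   x splits accordingly into two vectors for which the construction applies. *)

(** * Maps on words with heights *)

Section MulMorphism.
Variables (G K : groupType) (f : G -> K).
Hypothesis fM : forall x y, f (x * y)%g = (f x * f y)%g.
Local Open Scope group_scope.

Lemma mul_morph1 : f 1 = 1.
Proof. by apply: (mulgI (f 1)); rewrite -fM !mulg1. Qed.

Lemma mul_morphV x : f x^-1 = (f x)^-1.
Proof. by apply: (mulgI (f x)); rewrite -fM !mulgV mul_morph1. Qed.

Lemma mul_morphR x y : f [~ x, y] = [~ f x, f y].
Proof. by rewrite /commg /conjg !(fM, mul_morphV). Qed.

End MulMorphism.

Section IntPowers.
Variable G : groupType.
Local Open Scope group_scope.
Implicit Types x y : G.

Definition expgz x (n : int) : G :=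
  match n with Posz m => x ^+ m | Negz m => x ^- m.+1 end.

Lemma expgz0 x : expgz x 0 = 1. Proof. by []. Qed.

Lemma expgz1 x : expgz x 1 = x. Proof. by []. Qed.

Lemma expgzN x n : expgz x (- n)%R = (expgz x n)^-1.
Proof. by case: n => [[|n]|n] //=; rewrite ?invg1 ?invgK. Qed.

Lemma expgzS x n : expgz x (n + 1)%R = expgz x n * x.
Proof.
case: n => [n|[|n]]; first by rewrite -PoszD /= addn1 expgSr.
  by rewrite /= expg1 mulVg.
rewrite NegzE (_ : _ + 1 = - (n.+1%:Z))%R; last by lia.
by rewrite !expgzN /= (expgS x n.+1) invgM mulgVK.
Qed.

Lemma expgzD x m n : expgz x (m + n)%R = expgz x m * expgz x n.
Proof.
have posD (k : nat) j : expgz x (j + k%:Z)%R = expgz x j * expgz x k.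
  elim: k => [|k IH]; first by rewrite addr0 mulg1.
  by rewrite -addn1 PoszD addrA !expgzS IH mulgA.
case: n => n; first exact: posD.
have := posD n.+1 (m + Negz n)%R; rewrite NegzE subrK => ->.
by rewrite expgzN mulgK.
Qed.

Lemma expgzM x m n : expgz x (m * n)%R = expgz (expgz x m) n.
Proof.
have posM (k : nat) : expgz x (m * k%:Z)%R = expgz (expgz x m) k.
  elim: k => [|k IH]; first by rewrite mulr0.
  by rewrite -addn1 PoszD mulrDr mulr1 !expgzD IH.
case: n => n; first exact: posM.
by rewrite NegzE mulrN !expgzN posM.
Qed.

Lemma commute_expgz x y n : commute x y -> commute x (expgz y n).
Proof.
by move=> c; case: n => n /=; [|apply: commuteV]; apply: commuteX.
Qed.

Lemma commute_expgz2 x m n : commute (expgz x m) (expgz x n).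
Proof. by rewrite /commute -!expgzD addrC. Qed.

End IntPowers.

(** Relative to a subgroup [P], since [level_map] is multiplicative only on elements of height
    zero. *)
Lemma morph_expgz (G K : groupType) (P : G -> Prop) (f : G -> K) :
  (forall x y, P x -> P y -> f (x * y)%g = (f x * f y)%g) -> P 1%g ->
  (forall x, P x -> P x^-1%g) -> (forall x y, P x -> P y -> P (x * y)%g) ->
  forall x n, P x -> f (expgz x n) = expgz (f x) n.
Proof.
move=> fM P1 PV PM x n Px.
have f1 : f 1%g = 1%g by apply: (mulgI (f 1%g)); rewrite -fM // !mulg1.
have fV y : P y -> f y^-1%g = (f y)^-1%g.
  by move=> Py; apply: (mulgI (f y)); rewrite -fM ?mulgV //; apply: PV.
have PX k : P (x ^+ k)%g by elim: k => // k IH; rewrite expgS; apply: PM.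
have fX k : f (x ^+ k)%g = (f x ^+ k)%g.
  by elim: k => // k IH; rewrite !expgS fM // IH.
by case: n => k /=; rewrite ?fV ?fX.
Qed.

(* [F v n] is the value of the generator [v] read as an edge from height [n] to
   height [n + 1] of the infinite cyclic cover of the Salvetti complex given by
   [chi].  A family compatible with the commutation squares evaluates words
   starting at any height, and is multiplicative on words of height zero. *)
Section LevelMap.
Variables (V : finType) (e : rel V) (G : groupType) (F : V -> int -> G).

(** A letter [v^-1] read at height [n] runs backwards along the edge from [n - 1] to [n], hence the
    shift in its value. *)
Fixpoint word_level (n : int) (w : word V) : G :=
  match w with
  | [::] => 1%g
  | (v, false) :: w' => (F v n * word_level (n + 1) w')%g
  | (v, true) :: w' => ((F v (n - 1))^-1 * word_level (n - 1) w')%g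
  end.

Lemma word_level_cat n w w' : word_level n (w ++ w') =
  (word_level n w * word_level (n + word_val (fun _ => 1 : int) w) w')%g.
Proof.
elim: w n => [|[v []] w IH] n /=; first by rewrite /word_val big_nil addr0 mul1g.
  by rewrite IH mulgA -cat1s word_val_cat {2}/word_val big_seq1 addrA.
by rewrite IH mulgA -cat1s word_val_cat {2}/word_val big_seq1 addrA.
Qed.

Hypothesis FC : forall u v n, e u v -> (F u n * F v (n + 1) = F v n * F u (n + 1))%g.

Lemma word_level_eq w w' :
  raag_eq e w w' -> forall n, word_level n w = word_level n w'.
Proof.
elim=> //.
- by move=> ? ? ? _ h _ h' n; rewrite h.
- move=> w1 w1' w2 w2' h1 e1 _ e2 n; rewrite !word_level_cat e1 e2.
  by rewrite (word_val_eq _ h1).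
- by move=> v [] n /=; rewrite mulg1 ?subrK ?addrK ?mulVg ?mulgV.
- by move=> u v /FC h n /=; rewrite !mulg1.
Qed.

Definition level_map (n : int) (x : raag e) : G := word_level n (qrep x).

Lemma level_mapE n w : level_map n (raag_cls e w) = word_level n w.
Proof. by apply: word_level_eq; apply: qrepP. Qed.

Lemma level_map_gen n v : level_map n (raag_gen e v) = F v n.
Proof. by rewrite level_mapE /= mulg1. Qed.

Lemma level_mapM n x y :
  level_map n (x * y)%g = (level_map n x * level_map (n + chi x) y)%g.
Proof.
elim/raag_ind: x => w; elim/raag_ind: y => w'.
by rewrite [(_ * _)%g]raag_mulE !level_mapE /chi raag_homE word_level_cat.
Qed.

Lemma level_map1 n : level_map n 1%g = 1%g.
Proof. by rewrite level_mapE. Qed.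

Lemma level_mapV n x : level_map n x^-1%g = (level_map (n - chi x) x)^-1%g.
Proof.
apply: (mulIg (level_map (n - chi x) x)).
by have := level_mapM n x^-1%g x; rewrite mulVg level_map1 mulVg /chi raag_homV => <-.
Qed.

Lemma level_map_expgz n x k : chi x = 0 -> level_map n (expgz x k) = expgz (level_map n x) k.
Proof.
move=> x0; apply: (@morph_expgz _ _ (fun y => chi y = 0)) => //.
- by move=> y z hy _; rewrite level_mapM hy addr0.
- exact: raag_hom1.
- by move=> y hy; rewrite /chi raag_homV -/(chi y) hy oppr0.
- by move=> y z hy hz; rewrite /chi raag_homM -/(chi y) -/(chi z) hy hz addr0.
Qed.

End LevelMap.

Lemma raag_gen_ind (V : finType) (e : rel V) (P : raag e -> Prop) :
  P 1%g -> (forall v x, P x -> P (raag_gen e v * x)%g) ->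
  (forall v x, P x -> P ((raag_gen e v)^-1 * x)%g) -> forall x, P x.
Proof.
move=> P1 PM PV; elim/raag_ind; elim=> [//|[v b] w IH].
rewrite -cat1s -raag_mulE; case: b; last exact: PM.
by rewrite (_ : raag_cls e [:: (v, true)] = (raag_gen e v)^-1%g) ?[RHS]raag_invE //; apply: PV.
Qed.

Lemma chi_gen (V : finType) (e : rel V) v : chi (raag_gen e v) = 1.
Proof. exact: raag_hom_gen. Qed.

Lemma chiM (V : finType) (e : rel V) (x y : raag e) : chi (x * y)%g = chi x + chi y.
Proof. exact: raag_homM. Qed.

Lemma chiV (V : finType) (e : rel V) (x : raag e) : chi x^-1%g = - chi x.
Proof. exact: raag_homV. Qed.

Lemma raag_gen_comm (V : finType) (e : rel V) u v : e u v ->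
  commute (raag_gen e u) (raag_gen e v).
Proof.
move=> uv; rewrite /commute [LHS]raag_mulE [RHS]raag_mulE.
exact/raag_clsP/REcomm.
Qed.

Lemma raag_hom_expgz (V : finType) (e : rel V) (M : zmodType) (f : V -> M)
  (x : raag e) n : raag_hom f (expgz x n) = raag_hom f x *~ n.
Proof.
have hX k : raag_hom f (x ^+ k)%g = raag_hom f x *+ k.
  by elim: k => [|k IH]; rewrite ?raag_hom1 // expgS raag_homM IH mulrS.
by case: n => k /=; rewrite ?raag_homV ?hX // NegzE mulrNz.
Qed.

Lemma chi_expgz (V : finType) (e : rel V) (x : raag e) n : chi (expgz x n) = chi x * n.
Proof. by rewrite /chi raag_hom_expgz mulrzz. Qed.

(** * Twists and transvections *)

Section Transvections.
Variables (V : finType) (e : rel V).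

Definition basis_vec (v : V) : {ffun V -> int} := [ffun w => (w == v)%:R].

Definition expo (g : raag e) : {ffun V -> int} := raag_hom basis_vec g.

Definition dotz (phi : V -> int) (y : {ffun V -> int}) : int := \sum_v phi v * y v.

Definition transv (phi : V -> int) (x y : {ffun V -> int}) : {ffun V -> int} :=
  [ffun v => y v + x v * dotz phi y].

Lemma dotzD phi y z : dotz phi (y + z) = dotz phi y + dotz phi z.
Proof.
by rewrite /dotz -big_split; apply: eq_bigr => v _; rewrite ffunE mulrDr.
Qed.

Lemma dotzN phi y : dotz phi (- y) = - dotz phi y.
Proof. by rewrite /dotz -sumrN; apply: eq_bigr => v _; rewrite ffunE mulrN. Qed.

Lemma dotz_delta p m y : dotz (fun v => m *+ (v == p)) y = m * y p.
Proof.
rewrite /dotz (bigD1 p) //= eqxx big1 ?addr0 // => v ne.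
by rewrite (negbTE ne) mul0r.
Qed.

Lemma dotz_transv phi psi x y :
  dotz phi (transv psi x y) = dotz phi y + dotz phi x * dotz psi y.
Proof.
rewrite /dotz mulr_suml -big_split; apply: eq_bigr => v _.
by rewrite ffunE /= mulrDr mulrA.
Qed.

Lemma dotz_basis phi v : dotz phi (basis_vec v) = phi v.
Proof.
rewrite /dotz (bigD1 v) //= ffunE eqxx mulr1 big1 ?addr0 // => w ne.
by rewrite ffunE (negbTE ne) mulr0.
Qed.

Lemma dotzZ phi k y : dotz (fun v => k * phi v) y = k * dotz phi y.
Proof. by rewrite /dotz mulr_sumr; apply: eq_bigr => v _; rewrite mulrA. Qed.

Lemma dotzDl phi psi y : dotz (fun v => phi v + psi v) y = dotz phi y + dotz psi y.
Proof. by rewrite /dotz -big_split; apply: eq_bigr => v _; rewrite mulrDl. Qed.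

Lemma eq_dotz phi psi (y : {ffun V -> int}) :
  (forall v, y v != 0 -> phi v = psi v) -> dotz phi y = dotz psi y.
Proof.
move=> h; apply: eq_bigr => v _; case: (eqVneq (y v) 0) => [->|/h -> //].
by rewrite !mulr0.
Qed.

Lemma raag_hom_dotz (phi : V -> int) (g : raag e) : raag_hom phi g = dotz phi (expo g).
Proof.
elim/raag_gen_ind: g => [|v g IH|v g IH].
- by rewrite /expo !raag_hom1 /dotz big1 // => v _; rewrite ffunE mulr0.
- by rewrite /expo !raag_homM !raag_hom_gen IH dotzD dotz_basis.
rewrite /expo !raag_homM !raag_homV !raag_hom_gen IH dotzD -[in RHS]sub0r.
congr (_ + _); rewrite -(dotz_basis phi v) /dotz -sumrN; apply: eq_bigr => w _.
by rewrite !ffunE add0r mulrN.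
Qed.

Lemma chi_dotz (g : raag e) : chi g = dotz (fun=> 1) (expo g).
Proof. exact: raag_hom_dotz. Qed.

Section Twist.
Variables (phi psi : V -> int) (h : raag e).
Hypothesis chi_h : chi h = 0.

Let c u := commute (raag_gen e u) h.

Definition twist_gen v n : raag e :=
  (expgz h (- (psi v * n)) * raag_gen e v * expgz h (phi v + psi v * n))%g.

Lemma twist_gen_comm v n : c v -> twist_gen v n = (raag_gen e v * expgz h (phi v))%g.
Proof.
move=> cv; rewrite /twist_gen -(commute_expgz (- (psi v * n)) cv) -mulgA -expgzD.
by congr (_ * expgz _ _)%g; ring.
Qed.

(** A letter [v] commuting with [h] has value [v h^(phi v)] whatever [psi v] is. Raising the height
    of the other letter [u] by one conjugates its value by [h^(psi u)], and [psi u = phi v] makes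
    this compensate for moving [h^(phi v)] across. In the last case the powers of [h] between the
    two letters cancel. *)
Lemma twist_gen_square u v n : e u v ->
  [\/ c u /\ c v, c u /\ psi v = phi u, c v /\ psi u = phi v |
      [/\ phi u = phi v, psi u = phi u & psi v = phi u]] ->
  (twist_gen u n * twist_gen v (n + 1) = twist_gen v n * twist_gen u (n + 1))%g.
Proof.
move=> uv; have uvC := raag_gen_comm uv.
have half a b m : commute (raag_gen e a) (raag_gen e b) -> c b -> psi a = phi b ->
    (twist_gen a m * twist_gen b (m + 1) = twist_gen b m * twist_gen a (m + 1))%g.
  move=> abC cb ab; rewrite !(twist_gen_comm _ cb) /twist_gen ab.
  rewrite -[LHS]mulgA (mulgA (expgz h _) (raag_gen e b)) -(commute_expgz _ cb).
  rewrite -(mulgA (raag_gen e b)) -expgzD -!mulgA (mulgA (raag_gen e a)) abC.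
  rewrite -mulgA mulgA -(commute_expgz _ cb) -!mulgA; congr (_ * _)%g.
  rewrite [RHS]mulgA -expgzD; congr (expgz _ _ * (_ * expgz _ _))%g; ring.
case=> [[cu cv]|[cu vu]|[cv uv']|[e1 e2 e3]].
- rewrite !(twist_gen_comm _ cu) !(twist_gen_comm _ cv).
  rewrite -!mulgA (mulgA (expgz h _) (raag_gen e v)) -(commute_expgz _ cv).
  rewrite (mulgA (expgz h _) (raag_gen e u)) -(commute_expgz _ cu).
  by rewrite !mulgA uvC -!mulgA commute_expgz2.
- by symmetry; apply: half.
- exact: half.
rewrite /twist_gen e2 e3 -e1 -!mulgA; congr (_ * _)%g.
rewrite 2!(mulgA (expgz h _) (expgz h _)) -!expgzD.
rewrite (_ : phi u + phi u * n + - (phi u * (n + 1)) = 0); last by ring.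
by rewrite expgz0 !mul1g !mulgA uvC.
Qed.

Lemma chi_twist_gen v n : chi (twist_gen v n) = 1.
Proof. by rewrite /twist_gen !chiM !chi_expgz chi_gen chi_h !mul0r. Qed.

Hypothesis FC : forall u v n, e u v ->
  (twist_gen u n * twist_gen v (n + 1) = twist_gen v n * twist_gen u (n + 1))%g.

(** The powers [- psi v n] and [psi v n] of [h] cancel in the abelianization, so only [phi] survives
    and the height is irrelevant. *)
Lemma expo_level_map n (g : raag e) :
  expo (level_map twist_gen n g) = transv phi (expo h) (expo g).
Proof.
have ex v m : expo (twist_gen v m) = [ffun w => basis_vec v w + expo h w * phi v].
  rewrite /expo /twist_gen !raag_homM !raag_hom_expgz raag_hom_gen.
  by apply/ffunP => w; rewrite !(ffunE, ffunMzE, mulrzz); ring.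
elim/raag_gen_ind: g n => [|v g IH|v g IH] n.
- rewrite level_map1 // /expo raag_hom1; apply/ffunP => w.
  by rewrite !ffunE /dotz big1 ?mulr0 // => u _; rewrite ffunE mulr0.
- rewrite level_mapM // level_map_gen // {1}/expo raag_homM -!/(expo _) IH ex.
  apply/ffunP => w; rewrite /expo raag_homM raag_hom_gen -!/(expo _) !ffunE.
  by rewrite dotzD dotz_basis; ring.
rewrite level_mapM // level_mapV // level_map_gen // {1}/expo raag_homM raag_homV.
rewrite -!/(expo _) IH ex.
apply/ffunP => w; rewrite /expo raag_homM raag_homV raag_hom_gen -!/(expo _) !ffunE.
rewrite -[X in dotz phi (_ + X)]/(expo g) dotzD (_ : dotz phi (- _) = - phi v); last first.
  rewrite -(dotz_basis phi v) /dotz -sumrN; apply: eq_bigr => u _.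
  by rewrite !ffunE mulrN.
by ring.
Qed.

Lemma chi_level_map n (g : raag e) : chi (level_map twist_gen n g) = chi g.
Proof.
elim/raag_gen_ind: g n => [|v g IH|v g IH] n; first by rewrite level_map1.
  by rewrite level_mapM // level_map_gen // [LHS]chiM chi_twist_gen IH chiM chi_gen.
rewrite level_mapM // level_mapV // level_map_gen // [LHS]chiM !chiV chi_twist_gen IH.
by rewrite chiM chiV chi_gen.
Qed.

End Twist.

Lemma expgzMn (G : groupType) (x y : G) n :
  commute x y -> expgz (x * y)%g n = (expgz x n * expgz y n)%g.
Proof.
move=> c; have xX k : commute (x ^+ k)%g y.
  by apply/commute_sym/commuteX/commute_sym.
case: n => n /=; rewrite expgMn // invgM.
by rewrite -(commuteV (commute_sym (commuteV (commuteX2 _ _ c)))).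
Qed.

Section TwistWord.
Variables (x : {ffun V -> int}) (b : V).
Local Open Scope group_scope.

(** An element of height zero, of class [x] once the coordinates of [x] sum to zero. Its letters lie
    in the support of [x] or equal [b], so later conditions on the support also have to cover
    [b]. *)
Definition twist_word : raag e :=
  foldr (fun a g => expgz (raag_gen e a / raag_gen e b) (x a) * g) 1 (enum V).

Lemma chi_div u v : chi (raag_gen e u / raag_gen e v) = 0%R.
Proof. by rewrite chiM chiV !chi_gen subrr. Qed.

Lemma expo_twist_word : dotz (fun=> 1%R) x = 0%R -> expo twist_word = x.
Proof.
move=> x0; have -> : expo twist_word =
    (\sum_(a <- enum V) (basis_vec a - basis_vec b) *~ x a)%R.
  rewrite /twist_word; elim: (enum V) => [|a s IH] /=.
    by rewrite big_nil /expo raag_hom1.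
  rewrite big_cons -IH /expo raag_homM raag_hom_expgz raag_homM raag_homV.
  by rewrite !raag_hom_gen.
rewrite big_enum; apply/ffunP => v; rewrite sum_ffunE.
transitivity (\sum_a (x a * (v == a)%:R - x a * (v == b)%:R))%R.
  by apply: eq_bigr => a _; rewrite ffunMzE mulrzz !ffunE; ring.
rewrite sumrB -mulr_suml.
have -> : (\sum_a x a = 0)%R by rewrite -[RHS]x0; apply: eq_bigr => a _; rewrite mul1r.
rewrite mul0r subr0 (bigD1 v) //= eqxx mulr1 big1 ?addr0 // => a ne.
by rewrite eq_sym (negbTE ne) mulr0.
Qed.

Lemma chi_twist_word : chi twist_word = 0%R.
Proof.
rewrite /twist_word; elim: (enum V) => [|a s IH] /=; first exact: raag_hom1.
by rewrite chiM chi_expgz chi_div IH mul0r.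
Qed.

Lemma commute_twist_word (g : raag e) :
  (forall a, (x a != 0)%R -> commute g (raag_gen e a)) -> commute g (raag_gen e b) ->
  commute g twist_word.
Proof.
move=> ga gb; rewrite /twist_word; elim: (enum V) => [|a s IH] /=; first exact: commute1.
apply: commuteM => //; case: (eqVneq (x a) 0%R) => [->|xa]; first exact: commute1.
by apply/commute_expgz/commuteM; [apply: ga | apply: commuteV].
Qed.

Variables (phi psi : V -> int).
Let h := twist_word.
Let F := twist_gen phi psi h.
Hypothesis FC : forall u v n, e u v -> F u n * F v (n + 1)%R = F v n * F u (n + 1)%R.

Lemma level_map_twist_word n : level_map F n h =
  foldr (fun a g => expgz (F a n / F b n) (x a) * g) 1 (enum V).
Proof.
rewrite /h /twist_word; elim: (enum V) => [|a s IH] /=; first exact: level_map1.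
rewrite level_mapM // chi_expgz chi_div mul0r addr0 IH; congr (_ * _).
rewrite level_map_expgz ?chi_div //; congr (expgz _ _).
by rewrite level_mapM // level_mapV // !level_map_gen // !chi_gen addrK.
Qed.

(** On the letters of [h] the twist reads [a |-> h^(-tn) a h^(s + tn)]: a letter commuting with [h]
    may be given any [psi], in particular [t]. Hence [a b^-1] is conjugated by [h^(tn)], and [h] by
    a power of itself. *)
Lemma level_map_twist_const n s t :
  (forall a, (a == b) || (x a != 0%R) -> phi a = s /\ (commute (raag_gen e a) h \/ psi a = t)) ->
  level_map F n h = h.
Proof.
move=> ha; rewrite level_map_twist_word.
have Fa a : (a == b) || (x a != 0%R) ->
    F a n = expgz h (- (t * n)) * raag_gen e a * expgz h (s + t * n).
  move=> /ha[<- [c|<- //]]; rewrite /F twist_gen_comm //.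
  rewrite -(commute_expgz (- (t * n)) c) -mulgA -expgzD.
  by congr (_ * expgz _ _); ring.
transitivity (h ^ expgz h (t * n)); last by rewrite /conjg (commute_expgz _ (commute_refl h)) mulKg.
rewrite -[X in _ = X ^ _]/(foldr
  (fun a g => expgz (raag_gen e a / raag_gen e b) (x a) * g) 1 (enum V)).
elim: (enum V) => [|a r IH] /=; first by rewrite conj1g.
rewrite conjMg -IH; congr (_ * _).
case: (eqVneq (x a) 0%R) => [->|xa]; first by rewrite conj1g.
rewrite (@morph_expgz _ _ (fun=> True) (fun y => y ^ expgz h (t * n))) //; last first.
  by move=> y z _ _; rewrite conjMg.
by rewrite !Fa ?eqxx ?xa ?orbT // !invgM -!mulgA mulVKg /conjg !expgzN invgK -!mulgA.
Qed.

(** Here [a b^-1] goes to [a b^-1 h^(phi a - phi b)] with all powers of [h] central among the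
    letters involved; the total power gained is the pairing of [phi - phi b] with [x], which is
    zero. *)
Lemma level_map_twist_comm n :
  (forall a, (a == b) || (x a != 0%R) -> commute (raag_gen e a) h) ->
  dotz (fun=> 1%R) x = 0%R -> dotz phi x = 0%R -> level_map F n h = h.
Proof.
move=> ha x0 px; rewrite level_map_twist_word.
have cb : commute (raag_gen e b) h by apply: ha; rewrite eqxx.
have cab a k : (a == b) || (x a != 0%R) ->
    commute (expgz h k) (raag_gen e a / raag_gen e b).
  move=> /ha ca; apply/commute_sym/commute_expgz/commute_sym/commuteM.
    exact: commute_sym.
  exact/commuteV/commute_sym.
have Fab a : (a == b) || (x a != 0%R) ->
    F a n / F b n = raag_gen e a / raag_gen e b * expgz h (phi a - phi b).
  move=> xa; rewrite /F !twist_gen_comm //; last exact: ha.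
  rewrite invgM -expgzN mulgA -(mulgA (raag_gen e a)) -expgzD -!mulgA; congr (_ * _).
  exact/commuteV/commute_sym/commute_expgz.
have -> : foldr (fun a g => expgz (F a n / F b n) (x a) * g) 1 (enum V) =
    h * expgz h (\sum_(a <- enum V) (phi a - phi b) * x a)%R.
  rewrite -[X in _ = X * _]/(foldr
    (fun a g => expgz (raag_gen e a / raag_gen e b) (x a) * g) 1 (enum V)).
  elim: (enum V) => [|a s IH] /=; first by rewrite big_nil mulg1.
  rewrite IH big_cons expgzD.
  case: (eqVneq (x a) 0%R) => [->|xa]; first by rewrite mulr0 !expgz0 !mul1g.
  rewrite Fab ?xa ?orbT // expgzMn; last by apply/commute_sym/cab; rewrite xa orbT.
  rewrite -expgzM -!mulgA; congr (_ * _); rewrite !mulgA; congr (_ * _).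
  elim: s {IH} => [|c s IH] /=; first by rewrite mulg1 mul1g.
  rewrite mulgA; case: (eqVneq (x c) 0%R) => [->|xc]; first by rewrite expgz0 mulg1 mul1g.
  rewrite (commute_expgz (x c) (cab c _ _)) ?xc ?orbT // -mulgA IH mulgA.
  by [].
have -> : (\sum_(a <- enum V) (phi a - phi b) * x a = dotz phi x - phi b * dotz (fun=> 1) x)%R.
  rewrite big_enum /dotz mulr_sumr -sumrB; apply: eq_bigr => a _; ring.
by rewrite px x0 mulr0 subr0 mulg1.
Qed.

End TwistWord.

Definition realizable (T : {ffun V -> int} -> {ffun V -> int}) : Prop :=
  exists Psi : bb_aut e, forall h : bb e, expo (val (Psi h)) = T (expo (val h)).

Lemma expo_bb_sum (h : bb e) : dotz (fun=> 1) (expo (val h)) = 0.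
Proof. by rewrite -chi_dotz; apply/eqP: (valP h). Qed.

Lemma realizable_ext T T' : (forall y, dotz (fun=> 1) y = 0 -> T y = T' y) ->
  realizable T -> realizable T'.
Proof.
by move=> TT' [Psi PsiE]; exists Psi => h; rewrite PsiE TT' // expo_bb_sum.
Qed.

Lemma realizable_id : realizable id.
Proof. by exists (@BBAut _ e id id (fun _ _ => erefl) (fun=> erefl) (fun=> erefl)). Qed.

Lemma realizable_comp T T' : realizable T -> realizable T' -> realizable (T \o T').
Proof.
move=> [P PE] [Q QE].
have M x y : P (Q (x * y)%g) = (P (Q x) * P (Q y))%g by rewrite !aut_funM.
have K : cancel (P \o Q) (aut_inv Q \o aut_inv P) by apply: can_comp; apply: aut_funK.
have K' : cancel (aut_inv Q \o aut_inv P) (P \o Q) by apply: can_comp; apply: aut_invK.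
by exists (BBAut M K K') => h /=; rewrite PE QE.
Qed.

Section TwistInverse.
Variables (phi psi : V -> int) (h : raag e).
Hypothesis chi_h : chi h = 0.
Let F := twist_gen phi psi h.
Let F' := twist_gen (fun v => - phi v) (fun v => - psi v) h.
Hypothesis FC : forall u v n, e u v -> (F u n * F v (n + 1) = F v n * F u (n + 1))%g.
Hypothesis FC' :
  forall u v n, e u v -> (F' u n * F' v (n + 1) = F' v n * F' u (n + 1))%g.
Hypothesis fix_h' : forall n, level_map F' n h = h.

(** As [h] has height zero and is fixed by the second twist, the outer powers of [h] in [F v m] pass
    through unchanged and cancel those produced by [F' v m]. *)
Lemma level_map_twistK n (g : raag e) : level_map F' n (level_map F n g) = g.
Proof.
have key v m : level_map F' m (F v m) = raag_gen e v.
  rewrite /F /twist_gen !level_mapM // !chiM !chi_expgz chi_h !mul0r add0r addr0.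
  rewrite !level_map_expgz // !fix_h' level_map_gen // /F' /twist_gen.
  rewrite !mulgA -expgzD -!mulgA -expgzD.
  rewrite (_ : - (psi v * m) + - (- psi v * m) = 0); last by ring.
  rewrite (_ : - phi v + - psi v * m + (phi v + psi v * m) = 0); last by ring.
  by rewrite !expgz0 mul1g mulg1.
elim/raag_gen_ind: g n => [|v g IH|v g IH] n; first by rewrite !level_map1.
  by rewrite (level_mapM FC) level_mapM // level_map_gen // key chi_gen chi_twist_gen // IH.
rewrite (level_mapM FC) (level_mapM FC') level_mapV // level_map_gen // chi_gen.
by rewrite level_mapV // !chiV chi_gen chi_twist_gen // key IH.
Qed.

End TwistInverse.

Definition star_over (X : {set V}) (v : V) : bool := [forall c in X, (c == v) || e v c].

(** The four cases of [twist_gen_square], with commutation with [h] replaced by the combinatorial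
    condition that the star of the vertex contains [X]. *)
Definition twist_edge X (phi psi : V -> int) u v : Prop :=
  [\/ star_over X u /\ star_over X v, star_over X u /\ psi v = phi u,
      star_over X v /\ psi u = phi v | [/\ phi u = phi v, psi u = phi u & psi v = phi u]].

(** The two situations in which the twist fixes [h]: [level_map_twist_const] and
    [level_map_twist_comm]. *)
Definition twist_stable (X : {set V}) (phi psi : V -> int) : Prop :=
  (exists s t, forall a, a \in X -> phi a = s /\ (star_over X a \/ psi a = t))
  \/ (forall a, a \in X -> star_over X a).

Section DehnTwist.
Variables (X : {set V}) (b : V) (x : {ffun V -> int}).
Hypotheses (Xb : b \in X) (Xx : forall a, x a != 0 -> a \in X).
Hypothesis x_sum : dotz (fun=> 1) x = 0.
Let h := twist_word x b.

Lemma star_over_commute v : star_over X v -> commute (raag_gen e v) h.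
Proof.
move=> /forall_inP Xv.
have Xc c : c \in X -> commute (raag_gen e v) (raag_gen e c).
  by move=> /Xv /orP[/eqP->|/raag_gen_comm //]; apply: commute_refl.
by apply: commute_twist_word => [a /Xx/Xc|]; last exact: Xc.
Qed.

Lemma twist_edge_square phi psi : (forall u v, e u v -> twist_edge X phi psi u v) ->
  forall u v n, e u v -> (twist_gen phi psi h u n * twist_gen phi psi h v (n + 1)
    = twist_gen phi psi h v n * twist_gen phi psi h u (n + 1))%g.
Proof.
move=> E u v n uv; apply: twist_gen_square => //.
have c := star_over_commute.
by case: (E _ _ uv) => [[/c ? /c ?]|[/c ? ?]|[/c ? ?]|?];
  [constructor 1|constructor 2|constructor 3|constructor 4].
Qed.

Lemma twist_stable_fix phi psi : (forall u v, e u v -> twist_edge X phi psi u v) ->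
  dotz phi x = 0 -> twist_stable X phi psi ->
  forall n, level_map (twist_gen phi psi h) n h = h.
Proof.
move=> E px; have FC := twist_edge_square E.
have inX a : (a == b) || (x a != 0) -> a \in X by case/orP=> [/eqP->|/Xx].
case=> [[s [t st]]|st] n.
  apply: (@level_map_twist_const x b phi psi FC n s t) => a /inX /st[-> [/star_over_commute|]] //.
    by split=> //; left.
  by split=> //; right.
by apply: level_map_twist_comm => // a /inX /st /star_over_commute.
Qed.

(** All hypotheses are invariant under negating [phi] and [psi], so both twists exist and fix [h].
    They preserve [chi], and on [H] every factor starts at height zero, which makes them mutually
    inverse homomorphisms there. *)
Lemma dehn_twist phi psi : (forall u v, e u v -> twist_edge X phi psi u v) ->
  dotz phi x = 0 -> twist_stable X phi psi -> realizable (transv phi x).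
Proof.
move=> E px st; set nphi := fun v => - phi v; set npsi := fun v => - psi v.
have E' u v : e u v -> twist_edge X nphi npsi u v.
  rewrite /nphi /npsi => /E[h1|[h1 h2]|[h1 h2]|[h1 h2 h3]]; first by constructor 1.
  - by constructor 2; rewrite h2.
  - by constructor 3; rewrite h2.
  - by constructor 4; rewrite h2 h3 h1.
have st' : twist_stable X nphi npsi.
  case: st => [[s [t st]]|]; last by right.
  left; exists (- s), (- t) => a /st[<- []]; first by split=> //; left.
  by move=> <-; split=> //; right.
have px' : dotz nphi x = 0.
  rewrite -[LHS]/(dotz (fun v => - phi v) x) -oppr0 -px /dotz -sumrN.
  by apply: eq_bigr => v _; rewrite mulNr.
have FC := twist_edge_square E; have FC' := twist_edge_square E'.
have fx := twist_stable_fix E px st; have fx' := twist_stable_fix E' px' st'.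
have h0 : chi h = 0 := chi_twist_word x b.
pose F := twist_gen phi psi h; pose F' := twist_gen nphi npsi h.
have kerF phi' psi' (g : bb e) : (forall u v, e u v -> twist_edge X phi' psi' u v) ->
    ker_chi (level_map (twist_gen phi' psi' h) 0 (val g)).
  move=> E''; rewrite /ker_chi chi_level_map //; [exact: (valP g) | exact: twist_edge_square].
pose P (g : bb e) : bb e := exist (fun y => ker_chi y) _ (kerF phi psi g E).
pose Q (g : bb e) : bb e := exist (fun y => ker_chi y) _ (kerF nphi npsi g E').
have PM y z : P (y * z)%g = (P y * P z)%g.
  apply: val_inj; rewrite [RHS]gmulfM /= level_mapM //.
  by have /eqP-> : chi (val y) == 0 := valP y.
have PK : cancel P Q by move=> g; apply: val_inj; apply: level_map_twistK.
have QK : cancel Q P.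
  move=> g; apply: val_inj => /=.
  have := @level_map_twistK nphi npsi h h0 FC' _ _ 0 (val g).
  have -> : (fun v => - nphi v) = phi by apply/funext => v; rewrite /nphi opprK.
  have -> : (fun v => - npsi v) = psi by apply/funext => v; rewrite /npsi opprK.
  by apply.
exists (BBAut PM PK QK) => g /=.
by rewrite expo_level_map // expo_twist_word.
Qed.

End DehnTwist.

End Transvections.

(** * Realizing transvections *)

Section Realizability.
Variables (V : finType) (e : rel V).
Local Notation realizable := (@realizable V e).
Local Notation star_over := (star_over e).
Hypotheses (e_sym : symmetric e) (e_irr : irreflexive e).

(** The twist with [psi = 0] multiplies the letter [p] by [h^m] and fixes the others. It fixes [h]
    because [p] does not occur in [h], and it respects the edges at [p] because [h] commutes with
    every neighbour of [p]. *)
Lemma realizable_vertex_transv p (m : int) (X : {set V}) b (x : {ffun V -> int}) :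
  b \in X -> p \notin X -> (forall a, x a != 0 -> a \in X) -> dotz (fun=> 1) x = 0 ->
  (forall w, e p w -> star_over X w) ->
  realizable (transv (fun v => m *+ (v == p)) x).
Proof.
move=> Xb Xp Xx x0 lk; apply: (dehn_twist Xb Xx x0 (psi := fun=> 0)).
- move=> u v uv; have [up|up] := eqVneq u p.
    have vp : v != p by apply: contraTneq uv => ->; rewrite up e_irr.
    by constructor 3; rewrite (negbTE vp); split=> //; apply: lk; rewrite -up.
  have [vp|vp] := eqVneq v p.
    by constructor 2; rewrite (negbTE up); split=> //; apply: lk; rewrite -vp e_sym.
  by constructor 4; rewrite (negbTE up) (negbTE vp).
- rewrite (eq_dotz (psi := fun=> 0)) ?/dotz ?big1 // => v; first by rewrite mul0r.
  by move=> /Xx vX; rewrite (negbTE (memPn Xp _ vX)).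
- by left; exists 0, 0 => a aX; rewrite (negbTE (memPn Xp _ aX)); split=> //; right.
Qed.

Lemma star_overS (X Y : {set V}) v : Y \subset X -> star_over X v -> star_over Y v.
Proof.
by move=> /subsetP YX /forall_inP h; apply/forall_inP => c /YX; apply: h.
Qed.

(* Euclid's algorithm on the weights [phi]: conjugating by the elementary
   transvection [p |-> p (q b^-1)^(+-1)] replaces [phi p] by [phi p +- phi q]. *)
Lemma realizable_twin_transv (X : {set V}) b (phi : V -> int) (x : {ffun V -> int}) :
  b \in X -> phi b = 0 -> (forall p, phi p != 0 -> p \in X) ->
  (forall p w, phi p != 0 -> e p w -> star_over X w) ->
  (forall a, x a != 0 -> a \in X) -> dotz (fun=> 1) x = 0 -> dotz phi x = 0 ->
  realizable (transv phi x).
Proof.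
move=> Xb; have [n] := ubnP (\sum_v `|phi v|%N).
elim: n phi x => // n IH phi x le_n phib phiX lk Xx x0 px.
case: (pickP (fun pq : V * V => [&& pq.1 != pq.2, phi pq.1 != 0, phi pq.2 != 0
    & (`|phi pq.2| <= `|phi pq.1|)%N])) => [[p q] /= /and4P[npq pn0 qn0 le_qp]|none].
  have np_b : p != b by apply: contraNneq pn0 => ->; rewrite phib.
  have nq_b : q != b by apply: contraNneq qn0 => ->; rewrite phib.
  (* The sign for which adding [eps * phi q] strictly decreases the absolute value of [phi p]. *)
  pose eps : int := if (0 < phi p) == (0 < phi q) then -1 else 1.
  pose d := basis_vec q - basis_vec b.
  pose el m := transv (fun v => m *+ (v == p)) d.
  have dE v : d v = (v == q)%:R - (v == b)%:R by rewrite !ffunE.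
  have dp : d p = 0 by rewrite dE (negbTE npq) (negbTE np_b).
  have dotd psi : dotz psi d = psi q - psi b by rewrite dotzD dotzN !dotz_basis.
  have elE m y v : el m y v = y v + d v * (m * y p) by rewrite ffunE dotz_delta.
  have dotel psi m y : dotz psi (el m y) = dotz psi y + (psi q - psi b) * (m * y p).
    by rewrite dotz_transv dotd dotz_delta.
  have real_el m : realizable (el m).
    apply: (@realizable_vertex_transv _ _ [set q; b] b); rewrite ?in_set2 ?eqxx ?orbT //.
    - by rewrite negb_or npq.
    - by move=> a; rewrite dE in_set2; case: (a == q); case: (a == b).
    - move=> w pw; apply: star_overS (lk p w pn0 pw).
      by apply/subsetP => c /set2P[]-> //; apply: phiX.
  pose phi' v := phi v + (eps * phi q) *+ (v == p).
  pose x' := el (- eps) x.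
  have phi'E v : v != p -> phi' v = phi v by rewrite /phi' => /negbTE->; rewrite addr0.
  have dot' y : dotz phi' (el (- eps) y) = dotz phi y.
    by rewrite dotzDl dotz_delta dotel elE dp phib; ring.
  (* [el eps] and [el (- eps)] are inverse to each other since [d p = 0]; the conjugate of a
     transvection is the transvection with transported data [phi'], [x']. *)
  apply: (realizable_ext (T := el eps \o (transv phi' x' \o el (- eps)))).
    have tE (psi : V -> int) z y v : transv psi z y v = y v + z v * dotz psi y by rewrite ffunE.
    move=> y _; apply/ffunP => v.
    by rewrite [LHS]elE !(tE phi') dot' /x' !elE dp tE; ring.
  apply: realizable_comp; first exact: real_el.
  apply: realizable_comp; last exact: real_el.
  apply: IH.
  - rewrite -ltnS; apply: leq_ltn_trans le_n.
    rewrite (bigD1 p) // [X in (_ < X)%N](bigD1 p) //= -addSn.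
    rewrite (eq_bigr (fun v => `|phi v|%N)) => [|v vp]; last by rewrite phi'E.
    rewrite leq_add2r /phi' eqxx mulr1n /eps; move: pn0 qn0 le_qp.
    by case: ifP; lia.
  - by rewrite phi'E // eq_sym.
  - by move=> v; have [->|vp] := eqVneq v p; [move=> _ | rewrite phi'E //]; apply: phiX.
  - move=> v w; have [->|vp] := eqVneq v p; first by move=> _; apply: lk.
    by rewrite phi'E //; apply: lk.
  - move=> a; rewrite elE dE; case: (eqVneq a q) => [-> _|aq]; first exact: phiX.
    have [-> //|ab] := eqVneq a b.
    by rewrite subr0 mul0r addr0; apply: Xx.
  - by rewrite dotel subrr mul0r addr0.
  - by rewrite dot'.
case: (pickP (fun p => phi p != 0)) => [p pn0|phi0]; last first.
  apply: (realizable_ext (T := id)); last exact: realizable_id.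
  move=> y _; apply/ffunP => v; rewrite ffunE /dotz big1 ?mulr0 ?addr0 // => u _.
  by move/negbFE/eqP: (phi0 u) => ->; rewrite mul0r.
(* No reducible pair is left, so [phi] lives on the single vertex [p]. Then [dotz phi x = 0] forces
   [x p = 0], and [p] can be removed from [X]. *)
have phiE v : phi v = phi p *+ (v == p).
  have [-> //|vp] := eqVneq v p; rewrite mulr0n; apply/eqP; apply: contraT => vn0.
  have [le|/ltnW le] := leqP `|phi v| `|phi p|.
    by have := none (p, v); rewrite /= eq_sym vp pn0 vn0 le.
  by have := none (v, p); rewrite /= vp pn0 vn0 le.
have -> : phi = fun v => phi p *+ (v == p) by apply/funext.
have xp : x p = 0.
  apply/eqP; move: px; rewrite /dotz (bigD1 p) //= big1 ?addr0.
    by move/eqP; rewrite mulf_eq0 (negbTE pn0).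
  by move=> v vp; rewrite phiE (negbTE vp) mul0r.
have np_b : p != b by apply: contraNneq pn0 => ->; rewrite phib.
apply: (@realizable_vertex_transv _ _ (X :\ p) b) => //; rewrite ?setD11 //.
- by rewrite !inE eq_sym np_b.
- by move=> a xa; rewrite !inE Xx // andbT; apply: contraNneq xa => ->; rewrite xp.
- by move=> w /(lk p w pn0); apply/star_overS/subD1set.
Qed.

Definition supp (x : {ffun V -> int}) : {set V} := [set a | x a != 0].

Lemma in_supp x a : (a \in supp x) = (x a != 0). Proof. by rewrite inE. Qed.

Section Realization.
Hypothesis e_conn : forall u v, connect e u v.
Variable nb : V -> V.
Hypothesis nbP : forall v, e v (nb v).

Definition link_const (X : {set V}) (phi : V -> int) : Prop :=
  forall p u u', ~~ star_over X p -> e p u -> e p u' -> phi u = phi u'.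

Definition jump_star (X : {set V}) (phi : V -> int) : Prop :=
  forall u v, e u v -> phi u != phi v -> star_over X u || star_over X v.

(** Where the star of [v] does not contain [X], [phi] is constant on the link of [v], so
    [phi (nb v)] is the value at every neighbour. Elsewhere [v] commutes with [h] and the choice of
    [nb v] does not matter. *)
Lemma twist_edge_nb X phi : link_const X phi -> jump_star X phi ->
  forall u v, e u v -> twist_edge e X phi (phi \o nb) u v.
Proof.
move=> lc js u v uv; have vu : e v u by rewrite e_sym.
case: (boolP (star_over X u)) => Xu; case: (boolP (star_over X v)) => Xv.
- by constructor 1.
- by constructor 2; split=> //; apply: lc Xv (nbP v) vu.
- by constructor 3; split=> //; apply: lc Xu (nbP u) uv.
have uvE : phi u = phi v.
  by apply/eqP; apply: contraT => /(js _ _ uv); rewrite (negbTE Xu) (negbTE Xv).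
constructor 4; split=> //=; first by rewrite uvE; apply: lc Xu (nbP u) uv.
exact: lc Xv (nbP v) vu.
Qed.

(** By connectedness [phi] is constant, and constants pair to zero with the exponent vectors of
    [H]. *)
Lemma realizable_const_transv (phi : V -> int) x :
  (forall u v, e u v -> phi u = phi v) -> realizable (transv phi x).
Proof.
move=> phi_e; apply: (realizable_ext (T := id)); last exact: realizable_id.
move=> y y0; apply/ffunP => v; rewrite ffunE.
have phiv u : phi u = phi v.
  case/connectP: (e_conn u v) => p; elim: p u => [|w p IH] u /=; first by move=> _ ->.
  by case/andP=> /phi_e-> /IH.
suff -> : dotz phi y = 0 by rewrite mulr0 addr0.
rewrite (eq_dotz (psi := fun=> phi v * 1)) => [|u _]; last by rewrite mulr1.
by rewrite dotzZ y0 mulr0.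
Qed.

(** If some star of a vertex of [X] does not contain [X], all such vertices of [X] have the same
    value [t] on their links. The twist for [phi] may then move [h], so [phi] is split into a part
    constant on [X], realized by one twist, and a part supported on vertices of [X] of value other
    than [t], realized by Euclid's algorithm. *)
Lemma realizable_jump_star phi x : link_const (supp x) phi -> jump_star (supp x) phi ->
  dotz (fun=> 1) x = 0 -> dotz phi x = 0 -> realizable (transv phi x).
Proof.
move=> lc js x0 px; set X := supp x in lc js.
have Xx a : x a != 0 -> a \in X by rewrite in_supp.
have [phi_e|] := pselect (forall u v, e u v -> phi u = phi v).
  exact: realizable_const_transv.
move=> /existsNP[u0 /existsNP[v0 /not_implyP[uv0 /eqP jump]]].
have [c0 Xc0] : exists c0, star_over X c0.
  by case/orP: (js _ _ uv0 jump); [exists u0 | exists v0].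
case: (pickP (mem X)) => [a0 Xa0|X0]; last first.
  apply: (realizable_ext (T := id)); last exact: realizable_id.
  move=> y _; apply/ffunP => v; rewrite ffunE.
  by have := X0 v; rewrite /= in_supp => /negbFE/eqP->; rewrite mul0r addr0.
have [allX|] := pselect (forall a, a \in X -> star_over X a).
  apply: (dehn_twist Xa0 Xx x0 (psi := phi \o nb)) => //; last by right.
  exact: twist_edge_nb.
move=> /existsNP[a1 /not_implyP[Xa1 /negP nXa1]].
pose t := phi c0.
have e_c0 a : a \in X -> ~~ star_over X a -> e a c0.
  move=> Xa nXa; rewrite e_sym; have /orP[/eqP ac|//] := forall_inP Xc0 a Xa.
  by rewrite ac Xc0 in nXa.
have link_t a w : a \in X -> ~~ star_over X a -> e a w -> phi w = t.
  by move=> Xa nXa aw; apply: lc nXa aw (e_c0 a Xa nXa).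
have phiX_t a : a \in X -> phi a != t -> ~~ star_over X a.
  move=> Xa; apply: contra => sa; have /orP[/eqP a1a|aa1] := forall_inP sa a1 Xa1.
    by rewrite a1a sa in nXa1.
  by rewrite (link_t a1 a) // e_sym.
have link_P p w : p \in X -> phi p != t -> e p w -> star_over X w.
  move=> Xp pt pw; have nXp := phiX_t _ Xp pt.
  have := js _ _ pw; rewrite (link_t p w) // => /(_ pt).
  by rewrite (negbTE nXp).
(* If [t] is attained on [X], [b] is taken there. Either way a vertex of [X] whose value differs
   from [phi b] has value other than [t], so that [link_P] applies to it. *)
have [b Xb bP] : exists2 b, b \in X & forall p, p \in X -> phi p != phi b -> phi p != t.
  case: (pickP [pred b in X | phi b == t]) => [b /andP[Xb /eqP bt]|none].
    by exists b => // p _; rewrite bt.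
  by exists a0 => // p Xp _; have := none p; rewrite /= Xp /= => ->.
pose s := phi b.
pose phi2 v := if v \in X then phi v - s else 0.
pose phi1 v := phi v - phi2 v.
have phi2X v : phi2 v != 0 -> v \in X /\ phi v != t.
  rewrite /phi2; case: ifP; rewrite ?eqxx // => Xv; rewrite subr_eq0 => vs.
  by split=> //; apply: bP.
have phi1X a : a \in X -> phi1 a = s.
  by move=> Xa; rewrite /phi1 /phi2 Xa opprB addrC subrK.
have phi1E v w : ~~ star_over X v -> e v w -> phi1 w = phi w.
  move=> nXv vw; rewrite /phi1; suff -> : phi2 w = 0 by rewrite subr0.
  apply/eqP; apply: contraT => /phi2X[Xw wt].
  by move: nXv; rewrite (link_P w) // e_sym.
have phi1_x : dotz phi1 x = 0.
  rewrite (eq_dotz (psi := fun=> s * 1)) => [|v /Xx/phi1X ->]; last by rewrite mulr1.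
  by rewrite dotzZ x0 mulr0.
have phiE y : dotz phi y = dotz phi1 y + dotz phi2 y.
  by rewrite -dotzDl; apply: eq_dotz => v _; rewrite subrK.
have phi2_x : dotz phi2 x = 0 by move: px; rewrite phiE phi1_x add0r.
have lc1 : link_const X phi1.
  by move=> p u u' nXp pu pu'; rewrite !(phi1E p) //; apply: lc nXp pu pu'.
have js1 : jump_star X phi1.
  move=> u v uv; case: (boolP (star_over X u)) => //= nXu.
  case: (boolP (star_over X v)) => // nXv.
  rewrite (phi1E u v) // (phi1E v u) ?[e v u]e_sym // => /(js _ _ uv).
  by rewrite (negbTE nXu) (negbTE nXv).
have R1 : realizable (transv phi1 x).
  (* On [X] the function [phi1] is the constant [s], and its link value is [t] wherever the letter
     may fail to commute with [h]. *)
  apply: (dehn_twist Xb Xx x0 (psi := phi1 \o nb)) => //; first exact: twist_edge_nb.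
  left; exists s, t => a Xa; split; first exact: phi1X.
  case: (boolP (star_over X a)) => nXa; [by left | right].
  by rewrite /= (phi1E a) //; apply: (link_t a).
have R2 : realizable (transv phi2 x).
  apply: (realizable_twin_transv Xb) => //.
  - by rewrite /phi2 Xb subrr.
  - by move=> p /phi2X[].
  - by move=> p w /phi2X[Xp pt]; apply: link_P.
apply: realizable_ext (realizable_comp R1 R2) => y _; apply/ffunP => v /=.
rewrite ffunE dotz_transv phi1_x mul0r addr0 !ffunE phiE; ring.
Qed.

Lemma realizable_transv (phi : V -> int) (x : {ffun V -> int}) :
  (forall p u u' a, e p u -> e p u' -> phi u != phi u' -> x a != 0 -> (a == p) || e p a) ->
  (forall u v a, e u v -> phi u != phi v -> x a != 0 -> [|| a == u, a == v, e u a | e v a]) ->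
  dotz (fun=> 1) x = 0 -> dotz phi x = 0 -> realizable (transv phi x).
Proof.
move=> L1 L2 x0 px.
have lcX (Y : {set V}) : Y \subset supp x -> link_const Y phi.
  move=> /subsetP YX p u u' /forall_inPn[a /YX]; rewrite in_supp => xa nap pu pu'.
  by apply/eqP; apply: contraNT nap => /(L1 p u u' a pu pu') ->.
have [js|] := pselect (jump_star (supp x) phi).
  exact: realizable_jump_star (lcX _ _) js x0 px.
move=> /existsNP[u /existsNP[v /not_implyP[uv /not_implyP[juv /negP]]]].
rewrite negb_or => /andP[nu nv].
have vu : e v u by rewrite e_sym.
pose xs s : {ffun V -> int} := [ffun a => if phi a == s then x a else 0].
have xsE s a : xs s a != 0 -> phi a = s /\ x a != 0.
  by rewrite ffunE; have [->|] := eqVneq (phi a) s; rewrite ?eqxx.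
have suppS s : supp (xs s) \subset supp x.
  by apply/subsetP => a; rewrite !in_supp => /xsE[].
(* The edge [uv] violates [jump_star], so [phi] is constant on the link of [u], with value [phi v],
   and on the link of [v], with value [phi u]; these two stars cover the support of [x]. *)
have phi_x a : x a != 0 -> phi a = phi u \/ phi a = phi v.
  move=> xa; case/or4P: (L2 _ _ _ uv juv xa) => [/eqP->|/eqP->|ua|va].
  - by left.
  - by right.
  - by right; apply: lcX (subxx _) _ _ _ nu ua uv.
  by left; apply: lcX (subxx _) _ _ _ nv va vu.
have xE a : x a = xs (phi u) a + xs (phi v) a.
  rewrite !ffunE; have [->|/phi_x[]->] := eqVneq (x a) 0; first by do 2!case: ifP.
    by rewrite eqxx (negbTE juv) addr0.
  by rewrite eqxx eq_sym (negbTE juv) add0r.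
have dotxs s psi : dotz (fun a => phi a * psi a) (xs s) = s * dotz psi (xs s).
  by rewrite -dotzZ; apply: eq_dotz => a /xsE[-> _].
pose S s := dotz (fun=> 1) (xs s).
have dphi s : dotz phi (xs s) = s * S s.
  by rewrite -dotxs; apply: eq_dotz => a _; rewrite mulr1.
have xD : x = xs (phi u) + xs (phi v) by apply/ffunP => a; rewrite ffunE xE.
(* The two partial sums add up to zero, and so do their multiples by the distinct values [phi u] and
   [phi v]. *)
have S0 : S (phi u) = 0 /\ S (phi v) = 0.
  move: x0 px; rewrite {1 2}xD !dotzD !dphi -!/(S _) => s0 p0.
  have SvE : S (phi v) = - S (phi u) by apply/eqP; rewrite -addr_eq0 addrC s0.
  suff Su : S (phi u) = 0 by rewrite SvE Su oppr0.
  move: p0; rewrite SvE mulrN -mulrBl => /eqP.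
  by rewrite mulf_eq0 subr_eq0 (negbTE juv) /= => /eqP.
have real_s s : S s = 0 -> realizable (transv phi (xs s)).
  move=> Ss; apply: realizable_jump_star => //; first exact: lcX.
    move=> w z wz jwz; apply: contraT; rewrite negb_or => /andP[nw nz].
    (* A vertex [a] of the support outside the star of [w'] must be adjacent to [z'], and constancy
       on the link of [z'] gives [phi w' = phi a = s]. By symmetry both ends of the jump edge would
       have value [s]. *)
    have val_s w' z' : e w' z' -> phi w' != phi z' -> ~~ star_over (supp (xs s)) w' ->
        ~~ star_over (supp (xs s)) z' -> phi w' = s.
      move=> wz' j' /forall_inPn[a]; rewrite in_supp => /xsE[as_ xa].
      rewrite negb_or => /andP[aw na] nz'; rewrite -as_.
      have /or4P[/eqP aw'|/eqP az|wa|za] := L2 _ _ _ wz' j' xa.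
      - by rewrite aw' eqxx in aw.
      - by rewrite az wz' in na.
      - by rewrite wa in na.
      - by apply: lcX (suppS s) _ _ _ nz' _ za; rewrite e_sym.
    have zw : e z w by rewrite e_sym.
    have jzw : phi z != phi w by rewrite eq_sym.
    by move: (jwz); rewrite (val_s w z wz jwz nw nz) (val_s z w zw jzw nz nw) eqxx.
  by rewrite dphi Ss mulr0.
case: S0 => Su Sv.
apply: realizable_ext (realizable_comp (real_s _ Su) (real_s _ Sv)) => y _.
apply/ffunP => a; rewrite /= ffunE dotz_transv dphi Sv mulr0 mul0r addr0.
by rewrite [transv _ (xs (phi v)) _ _]ffunE [RHS]ffunE xE; ring.
Qed.

End Realization.

End Realizability.

(** * Cubic relations *)

Lemma grcls_conj_prod (G : groupType) n (p q c d g k : G) :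
  lcs n p -> lcs n q -> lcs n.+1 c -> lcs n.+1 d ->
  grcls n (p ^ g * c * (d * q ^ k))%g = grcls n p + grcls n q.
Proof.
move=> hp hq hc hd; have lc := lcs_S hc; have ld := lcs_S hd.
have lp := lcs_J g hp; have lq := lcs_J k hq.
rewrite (grclsM (lcs_M lp lc) (lcs_M ld lq)) (grclsM lp lc) (grclsM ld lq) !grclsJ //.
by move/(grcls_eq0 lc): hc => ->; move/(grcls_eq0 ld): hd => ->; rewrite addr0 add0r.
Qed.

(* An endomorphism [sigma] of [G] that is trivial on [G / lcs 2] acts on the
   associated graded Lie ring as 1 + D with [D] a derivation of degree one,
   induced by [g |-> g^-1 sigma(g)]. *)
Section GradedDerivation.
Variables (G : groupType) (sigma : G -> G).
Hypothesis sigmaM : forall x y, sigma (x * y)%g = (sigma x * sigma y)%g.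
Local Open Scope group_scope.

Definition lcs_der (x : G) : G := x^-1 * sigma x.

Lemma sigma_der x : sigma x = x * lcs_der x.
Proof. by rewrite /lcs_der mulVKg. Qed.

Lemma lcs_derM x y : lcs_der (x * y) = lcs_der x ^ y * lcs_der y.
Proof. by rewrite /lcs_der sigmaM /conjg invgM -!mulgA mulVKg. Qed.

Lemma lcs_derV x : lcs_der x^-1 = ((lcs_der x)^-1) ^ x^-1.
Proof. by rewrite /lcs_der (mul_morphV sigmaM) /conjg !gnorm. Qed.

Hypothesis der2 : forall x, lcs 2 (lcs_der x).

Lemma lcs_derR x y : let a := lcs_der x in let b := lcs_der y in
  exists c d, [/\ lcs 4 c, lcs 4 d &
    lcs_der [~ x, y] = [~ x, b] ^ (a * [~ x, y]) * c * (d * [~ a, y] ^ b)].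
Proof.
move=> a b; exists [~ [~ x, y], b * a], [~ a, b].
have la : lcs 2 a := der2 x; have lb : lcs 2 b := der2 y.
have lxy : lcs 2 [~ x, y] by apply: (@lcs_R _ 1 1).
split; [apply: (@lcs_R _ 2 2) => //; exact: lcs_M | exact: (@lcs_R _ 2 2)|].
rewrite {1}/lcs_der (mul_morphR sigmaM) (sigma_der x) (sigma_der y) -/a -/b.
by rewrite /commg /conjg !gnorm.
Qed.

Lemma lcs_der3 x : lcs 2 x -> lcs 3 (lcs_der x).
Proof.
elim=> {x}.
- move=> z [x [y [_ ->]]]; have [c [d [lc ld ->]]] := lcs_derR x y.
  apply: lcs_M; [apply: lcs_M|apply: lcs_M].
  + by apply: lcs_J; apply: (@lcs_R _ 1 2).
  + exact: lcs_S.
  + exact: lcs_S.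
  + by apply: lcs_J; apply: (@lcs_R _ 2 1).
- by rewrite /lcs_der (mul_morph1 sigmaM) mulVg; apply: lcs_1.
- by move=> x y _ hx _ hy; rewrite lcs_derM; apply: lcs_M => //; apply: lcs_J.
- by move=> x _ hx; rewrite lcs_derV; apply/lcs_J/lcs_V.
Qed.

Lemma grcls_derR x y : grcls 3 (lcs_der [~ x, y]) =
  (grcls 3 [~ x, lcs_der y] + grcls 3 [~ lcs_der x, y])%R.
Proof.
have [c [d [lc ld ->]]] := lcs_derR x y.
have h1 : lcs 3 [~ x, lcs_der y] by apply: (@lcs_R _ 1 2).
have h2 : lcs 3 [~ lcs_der x, y] by apply: (@lcs_R _ 2 1).
exact: grcls_conj_prod.
Qed.

(* If [x o] and [y o] commute, where [o] induces [sigma] by conjugation, then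
   [[x, y] = D x - D y] in degree two; in the holonomy Lie algebra of [A] this is
   the expansion of [[u - o, v - o]] for an edge [uv]. *)
Lemma gr_telescope x y : x * sigma y = y * sigma x ->
  let tau z := (gr_br 3 (grcls 1 z) (grcls 2 (lcs_der z)) - grcls 3 (lcs_der (lcs_der z)))%R in
  (gr_br 3 (grcls 1 x + grcls 1 y) (gr_br 2 (grcls 1 x) (grcls 1 y)) = tau x - tau y)%R.
Proof.
move=> xy tau; set a := lcs_der x; set b := lcs_der y.
have la : lcs 2 a := der2 x; have lb : lcs 2 b := der2 y.
(* The hypothesis reads [x y b = y x a]. *)
have Rxy : [~ x, y] = a * b^-1.
  apply: (mulIg b); rewrite mulgVK; apply: (mulgI (y * x)).
  by rewrite mulgA -commgC -!mulgA /a /b /lcs_der !mulVKg.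
have brE (u v : G) : lcs 1 u -> lcs 2 v -> gr_br 3 (grcls 1 u) (grcls 2 v) = grcls 3 [~ u, v].
  exact: (@gr_brE _ 1 2).
have e2 : gr_br 2 (grcls 1 x) (grcls 1 y) = (grcls 2 a - grcls 2 b)%R.
  by rewrite (@gr_brE _ 1 1) // Rxy grclsM ?grclsV //; apply: lcs_V.
(* [D] is applied to both expressions of [[~ x, y]]. *)
have e3 : (grcls 3 (lcs_der a) - grcls 3 (lcs_der b))%R =
    (grcls 3 [~ x, b] + grcls 3 [~ a, y])%R.
  rewrite -grcls_derR Rxy lcs_derM lcs_derV.
  have l3a := lcs_der3 la; have l3b := lcs_der3 lb.
  have lVb := lcs_V l3b.
  by rewrite (grclsM (lcs_J _ l3a) (lcs_J _ lVb)) !grclsJ // grclsV.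
rewrite e2 gr_brDr gr_brNr !gr_brDl /tau -/a -/b !brE //.
have -> : grcls 3 [~ y, a] = (- grcls 3 [~ a, y])%R.
  by rewrite -grclsV ?invgR //; apply: (@lcs_R _ 2 1).
move/eqP: e3; rewrite subr_eq => /eqP ->.
by rewrite !opprD opprK !addrA [RHS](ACl (1*3*2*5*4*6))%AC /= subrK.
Qed.

End GradedDerivation.

Section HeightConjugation.
Variables (V : finType) (e : rel V).
Hypothesis e_conn : forall u v, connect e u v.
Variable o : V.
Local Open Scope group_scope.
Local Notation gen := (raag_gen e).

Lemma lcs_morph (G : groupType) (f : G -> G) n x :
  (forall y z, f (y * z) = f y * f z) -> lcs n x -> lcs n (f x).
Proof.
move=> fM; elim: n x => [|[|n] IH] // x; elim=> {x}.
- move=> x [y [z [hz ->]]]; rewrite (mul_morphR fM).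
  by apply: gen_in; exists (f y), (f z); split=> //; apply: IH.
- by rewrite (mul_morph1 fM); apply: lcs_1.
- by move=> x y _ hx _ hy; rewrite fM; apply: lcs_M.
- by move=> x _ hx; rewrite (mul_morphV fM); apply: lcs_V.
Qed.

Lemma bb_valM (x y : bb e) : val (x * y) = val x * val y.
Proof. by rewrite gmulfM. Qed.

Lemma bb_valV (x : bb e) : val x^-1 = (val x)^-1.
Proof. by rewrite gmulfV. Qed.

Fact height_conj_subproof (g : raag e) (h : bb e) : ker_chi (g * val h / g).
Proof.
have /eqP h0 : chi (val h) == 0%R := valP h.
by rewrite /ker_chi !chiM chiV h0 addr0 subrr.
Qed.
Definition height_conj g h : bb e := exist (fun x => ker_chi x) _ (height_conj_subproof g h).

Lemma val_height_conj g h : val (height_conj g h) = g * val h / g.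
Proof. by []. Qed.

Lemma val_bb_diff u v : val (bb_diff e u v) = gen u / gen v.
Proof. by []. Qed.

Definition bb_valE := (bb_valM, bb_valV, val_height_conj, val_bb_diff).

Lemma height_conjM g (h k : bb e) : height_conj g (h * k) = height_conj g h * height_conj g k.
Proof. by apply: val_inj; rewrite !bb_valE -!mulgA mulKg. Qed.

Local Notation sigma := (height_conj (gen o)).

(** As [v] commutes with [v w^-1], conjugation by [o] acts on it like conjugation by [o v^-1], an
    element of [H]. *)
Lemma lcs_der_edge v w : e v w -> lcs 2 (lcs_der sigma (bb_diff e v w)).
Proof.
move=> vw; have -> : lcs_der sigma (bb_diff e v w) =
    [~ bb_diff e v w, (bb_diff e o v)^-1].
  apply: val_inj; rewrite /lcs_der /commg /conjg !bb_valE !invgM !invgK.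
  by rewrite [in LHS](commuteV (raag_gen_comm vw)) !gnorm.
exact: (@lcs_R _ 1 1).
Qed.

(** Walks to [o] extend the edge case to all [v o^-1]. From these, products, inverses and
    conjugations by [o], which commute with [sigma], give every [x o^(- chi x)] by induction on
    words, and this is [x] itself for [x] in [H]. *)
Lemma lcs_der_height_conj (h : bb e) : lcs 2 (lcs_der sigma h).
Proof.
have sM := height_conjM (gen o).
have der1 : lcs 2 (lcs_der sigma 1) by rewrite /lcs_der (mul_morph1 sM) mulVg; apply: lcs_1.
have derM x y : lcs 2 (lcs_der sigma x) -> lcs 2 (lcs_der sigma y) ->
    lcs 2 (lcs_der sigma (x * y)).
  by move=> hx hy; rewrite (lcs_derM sM); apply: lcs_M => //; apply: lcs_J.
have derV x : lcs 2 (lcs_der sigma x) -> lcs 2 (lcs_der sigma x^-1).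
  by move=> hx; rewrite (lcs_derV sM); apply/lcs_J/lcs_V.
have der_conj g x : commute g (gen o) -> lcs 2 (lcs_der sigma x) ->
    lcs 2 (lcs_der sigma (height_conj g x)).
  move=> go hx; suff -> : lcs_der sigma (height_conj g x) = height_conj g (lcs_der sigma x).
    by apply: lcs_morph hx; apply: height_conjM.
  apply: val_inj; rewrite /lcs_der !bb_valE; move: (val x) => y.
  have -> : gen o * (g * y / g) / gen o = (gen o * g) * y / (gen o * g) by rewrite !gnorm.
  by rewrite -go !gnorm.
have der_diff v : lcs 2 (lcs_der sigma (bb_diff e v o)).
  case/connectP: (e_conn v o) => p; elim: p v => [|w p IH] v /=.
    move=> _ <-; rewrite (_ : bb_diff e o o = 1) //.
    by apply: val_inj; rewrite val_bb_diff mulgV.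
  case/andP=> vw /IH{}IH /IH{}IH.
  have -> : bb_diff e v o = bb_diff e v w * bb_diff e w o.
    by apply: val_inj; rewrite !bb_valE -mulgA mulKg.
  by apply: derM => //; apply: lcs_der_edge.
pose shift (x : raag e) := x * expgz (gen o) (- chi x)%R.
have shift_ker x : ker_chi (shift x).
  by rewrite /ker_chi chiM chi_expgz chi_gen mul1r subrr.
pose hs x : bb e := exist (fun y => ker_chi y) _ (shift_ker x).
have val_hs x : val (hs x) = shift x by [].
have hsP x : lcs 2 (lcs_der sigma (hs x)).
  elim/raag_gen_ind: x => [|v x IH|v x IH].
  - rewrite (_ : hs 1 = 1) //.
    by apply: val_inj; rewrite /= /shift /chi raag_hom1 mulg1.
  - have -> : hs (gen v * x) = bb_diff e v o * sigma (hs x).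
      apply: val_inj; rewrite !bb_valE !val_hs /shift chiM chi_gen opprD addrC expgzD.
      by rewrite (_ : expgz (gen o) (-1)%R = (gen o)^-1) ?gnorm.
    by apply: derM => //; apply: der_conj.
  have -> : hs ((gen v)^-1 * x) = height_conj (gen o)^-1 ((bb_diff e v o)^-1 * hs x).
    apply: val_inj; rewrite !bb_valE !val_hs /shift chiM chiV chi_gen opprD addrC expgzD.
    by rewrite opprK expgz1 !gnorm.
  by apply: der_conj; [apply/commute_sym/commuteV/commute_refl | apply: derM => //; apply: derV].
rewrite (_ : h = hs (val h)) //; apply: val_inj; rewrite /= /shift.
by have /eqP-> : chi (val h) == 0%R := valP h; rewrite oppr0 mulg1.
Qed.

End HeightConjugation.

Section WalkSum.
Variables (T : Type) (M : zmodType).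
Implicit Types (f : T -> T -> M) (p : seq T).

Fixpoint walk_sum f x p : M :=
  if p is y :: p' then f x y + walk_sum f y p' else 0.

Lemma walk_sum_rcons f x p y : walk_sum f x (rcons p y) = walk_sum f x p + f (last x p) y.
Proof. by elim: p x => [|z p IH] x /=; rewrite ?addr0 ?add0r // IH addrA. Qed.

End WalkSum.

Lemma walk_sum_morph (T : Type) (M N : zmodType) (g : M -> N) f (x : T) p :
  g 0 = 0 -> {morph g : a b / a + b} ->
  g (walk_sum f x p) = walk_sum (fun y z => g (f y z)) x p.
Proof. by move=> g0 gD; elim: p x => //= y p IH x; rewrite gD IH. Qed.

Section CubicRelations.
Variables (V : finType) (e : rel V).
Hypothesis e_conn : forall u v, connect e u v.
Variable o : V.

Lemma agr_lie_in1 (G : groupType) (x : grQ G 1) (c : assoc_gr G) n :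
  lie (agr_in1 x) c n.+1 = grQ_br n.+1 x (c n).
Proof.
have -> : lie (agr_in1 x) c n.+1 = agr_lie (agr_in1 x) c n.+1 by [].
rewrite /agr_lie (bigD1 (lift ord0 ord0)) //= [X in _ + X]big1 ?addr0; last first.
  move=> [[|[|p]] lt_p] //= _; rewrite big1 // => q _; exact: grQ_br0l.
have lt_n : (n < n.+2)%N by [].
rewrite (bigD1 (Ordinal lt_n)) //= big1 ?addr0 // => q ne.
by apply: grQ_br0; apply: contraNneq ne => -[qn]; apply/eqP/val_inj.
Qed.

Lemma lie_canon_cubic (a b c : LQ V) :
  lie_canon e (lie (fl_var a) (lie (fl_var b) (fl_var c))) 3 =
  grQ_br 3 (H1_incl e a) (grQ_br 2 (H1_incl e b) (H1_incl e c)).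
Proof. by rewrite !lie_canon_lie !lie_canon_var !agr_lie_in1. Qed.

Definition edge_cubic (u v : V) : freeLie (LQ V) :=
  lie (fl_var (std_diff u o + std_diff v o))
      (lie (fl_var (std_diff u o)) (fl_var (std_diff v o))).

Lemma freeLie_deg_cubic (a b c : LQ V) :
  freeLie_deg 3 (lie (fl_var a) (lie (fl_var b) (fl_var c))).
Proof.
by apply: (@FLdeg_br _ _ 1 2); [|apply: (@FLdeg_br _ _ 1 1)]; apply: FLdeg_var.
Qed.

(** With [U = u o^-1] and [V = v o^-1] one has [U sigma(V) = u v o^-2], symmetric in [u] and [v]
    when they commute; this is the hypothesis of [gr_telescope]. *)
Lemma lie_canon_edge : exists tau : V -> grQ (bb e) 3,
  forall u v, e u v -> lie_canon e (edge_cubic u v) 3 = tau u - tau v.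
Proof.
set sigma := height_conj (raag_gen e o).
have sM : forall x y, sigma (x * y)%g = (sigma x * sigma y)%g := height_conjM _.
have d2 : forall x, lcs 2 (lcs_der sigma x) := lcs_der_height_conj e_conn o.
pose z u : bb e := bb_diff e u o.
exists (fun u => tens (gr_br 3 (grcls 1 (z u)) (grcls 2 (lcs_der sigma (z u)))
                       - grcls 3 (lcs_der sigma (lcs_der sigma (z u)))) 1).
move=> u v uv; rewrite lie_canon_cubic linearD /= !H1_incl_std_diff -tens_addl.
rewrite (grQ_brE 2) (grQ_brE 3) !mulr1 -tensN -tens_addl; congr (tens _ 1).
apply: (gr_telescope sM d2); apply: val_inj.
by rewrite /sigma !bb_valE !gnorm (raag_gen_comm uv).
Qed.

Lemma rel_ideal_walk x p : path e x p -> last x p = x ->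
  rel_ideal e 3 (walk_sum edge_cubic x p).
Proof.
move=> xp lp; split.
  elim: p x {xp lp} => [|y p IH] x /=; first exact: FLdeg0.
  by apply: FLdegD => //; apply: freeLie_deg_cubic.
have [tau tauE] := lie_canon_edge.
suff -> : lie_canon e (walk_sum edge_cubic x p) 3 = tau x - tau (last x p).
  by rewrite lp subrr.
elim: p x xp {lp} => [|y p IH] x /=; first by rewrite linear0 subrr.
by case/andP=> xy /IH E; rewrite lie_canonD agrD E tauE // addrA subrK.
Qed.

End CubicRelations.

(** * Detection in a nilpotent quotient *)

(* The group Z^2 |x Z[X, Y]/(X^2, Y^2), where (s, t) acts by (1 + X)^s (1 + Y)^t;
   (s, t, a, b, c, d) stands for ((s, t), a + b X + c Y + d X Y). *)
Definition trunc_group : Type := (int * int * int * int * int * int)%type.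
HB.instance Definition _ := Choice.on trunc_group.

Definition trunc_mul (g h : trunc_group) : trunc_group :=
  let: (s, t, a, b, c, d) := g in let: (s', t', a', b', c', d') := h in
  (s + s', t + t', a + a', b + b' + s * a', c + c' + t * a',
   d + d' + s * c' + t * b' + s * t * a').
Definition trunc_inv (g : trunc_group) : trunc_group :=
  let: (s, t, a, b, c, d) := g in
  (- s, - t, - a, - b + s * a, - c + t * a, - d + s * c + t * b - s * t * a).
Definition trunc_one : trunc_group := (0, 0, 0, 0, 0, 0).

Fact trunc_mulA : associative trunc_mul.
Proof.
move=> [[[[[s t] a] b] c] d] [[[[[s' t'] a'] b'] c'] d'] [[[[[s2 t2] a2] b2] c2] d2] /=.
by congr (_, _, _, _, _, _); ring.
Qed.
Fact trunc_mul1 : left_id trunc_one trunc_mul.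
Proof. by move=> [[[[[s t] a] b] c] d] /=; congr (_, _, _, _, _, _); ring. Qed.
Fact trunc_mulr1 : right_id trunc_one trunc_mul.
Proof. by move=> [[[[[s t] a] b] c] d] /=; congr (_, _, _, _, _, _); ring. Qed.
Fact trunc_mulV : left_inverse trunc_one trunc_inv trunc_mul.
Proof. by move=> [[[[[s t] a] b] c] d] /=; congr (_, _, _, _, _, _); ring. Qed.
Fact trunc_mulrV : right_inverse trunc_one trunc_inv trunc_mul.
Proof. by move=> [[[[[s t] a] b] c] d] /=; congr (_, _, _, _, _, _); ring. Qed.
HB.instance Definition _ := isGroup.Build trunc_group
  trunc_mulA trunc_mul1 trunc_mulr1 trunc_mulV trunc_mulrV.

Definition trunc_top (g : trunc_group) : int := g.2.

(** The filtration with [s, t, a] in degree 1, [b, c] in degree 2 and [d] in degree 3; it contains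
    the lower central series and vanishes from degree 4 on. *)
Definition trunc_deg (n : nat) (g : trunc_group) : Prop :=
  let: (s, t, a, b, c, d) := g in
  [/\ (1 < n)%N -> [/\ s = 0, t = 0 & a = 0], (2 < n)%N -> b = 0 /\ c = 0
    & (3 < n)%N -> d = 0].

Lemma trunc_degM n g h : trunc_deg n g -> trunc_deg n h -> trunc_deg n (g * h)%g.
Proof.
case: g => [[[[[s t] a] b] c] d]; case: h => [[[[[s' t'] a'] b'] c'] d'].
move=> [h1 h2 h3] [k1 k2 k3]; split=> ln.
- by have [-> -> ->] := h1 ln; have [-> -> ->] := k1 ln.
- have [-> ->] := h2 ln; have [-> ->] := k2 ln.
  by have [_ _ ->] := k1 (ltnW ln); rewrite !mulr0.
have [-> ->] := k2 (ltnW ln); have [_ _ ->] := k1 (ltnW (ltnW ln)).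
by rewrite (h3 ln) (k3 ln) !mulr0.
Qed.

Lemma trunc_degV n g : trunc_deg n g -> trunc_deg n g^-1%g.
Proof.
case: g => [[[[[s t] a] b] c] d] [h1 h2 h3]; split=> ln.
- by have [-> -> ->] := h1 ln.
- by have [-> ->] := h2 ln; have [_ _ ->] := h1 (ltnW ln); rewrite !mulr0.
have [-> ->] := h2 (ltnW ln); have [_ _ ->] := h1 (ltnW (ltnW ln)).
by rewrite (h3 ln) !mulr0 subr0.
Qed.

Lemma trunc_commE (g h : trunc_group) : [~ g, h]%g =
  trunc_mul (trunc_inv g) (trunc_mul (trunc_inv h) (trunc_mul g h)).
Proof. by []. Qed.

Lemma trunc_degR n g h : trunc_deg n.+1 h -> trunc_deg n.+2 [~ g, h]%g.
Proof.
rewrite trunc_commE.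
case: g => [[[[[s t] a] b] c] d]; case: h => [[[[[s' t'] a'] b'] c'] d'].
move=> [k1 k2 k3]; split=> ln.
- by split; ring.
- have [-> -> ->] := k1 ln; split; ring.
have [-> ->] := k2 ln; have [-> -> ->] := k1 (ltnW ln); ring.
Qed.

Lemma trunc_deg_lcs (G : groupType) (f : G -> trunc_group) n x :
  (forall y z, f (y * z)%g = (f y * f z)%g) -> lcs n x -> trunc_deg n (f x).
Proof.
move=> fM.
elim: n x => [|[|n] IH] x; try by case: (f x) => [[[[[s t] a] b] c] d].
elim=> {x}.
- move=> x [y [z [hz ->]]]; rewrite (mul_morphR fM).
  exact/trunc_degR/IH.
- by rewrite (mul_morph1 fM); split.
- by move=> x y _ hx _ hy; rewrite fM; apply: trunc_degM.
- by move=> x _ hx; rewrite (mul_morphV fM); apply: trunc_degV.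
Qed.

Lemma trunc_top_triple g h k : trunc_top [~ g, [~ h, k]]%g =
  let: (s, t, _, _, _, _) := g in
  let: (s1, t1, a1, _, _, _) := h in let: (s2, t2, a2, _, _, _) := k in
  s * (t1 * a2 - t2 * a1) + t * (s1 * a2 - s2 * a1).
Proof.
rewrite !trunc_commE.
case: g => [[[[[s t] a] b] c] d]; case: h => [[[[[s1 t1] a1] b1] c1] d1].
case: k => [[[[[s2 t2] a2] b2] c2] d2].
rewrite /trunc_top /=. ring.
Qed.

Section TensLift.
Variables (A : zmodType) (f : A -> int).
Hypothesis fD : forall a b, f (a + b) = f a + f b.

Definition tens_lift (x : tensQ A) : rat := (qrep x).2 * (f (qrep x).1)%:~R.

Lemma tens_liftE a q : tens_lift (tens a q) = q * (f a)%:~R.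
Proof.
have f0 : f 0 = 0 by apply: (addrI (f 0)); rewrite -fD !addr0.
have fN x : f (- x) = - f x by apply/eqP; rewrite -addr_eq0 -fD addNr f0.
have fn x (n : nat) : f (x *+ n) = f x * n.
  by elim: n => [|n IH]; rewrite ?mulr0n ?f0 ?mulr0 // mulrSr fD IH -addn1 PoszD mulrDr mulr1.
have fz x n : f (x *~ n) = f x * n.
  by case: n => n; rewrite ?NegzE ?mulrNz -pmulrn ?fN fn ?mulrN.
rewrite /tens_lift; have := qrepP (tens_eq_equiv A) (a, q).
case: (qrep _) => b r [N [m [n [/= N0 rm qn e]]]].
have N0' : N%:~R != 0 :> rat by rewrite intr_eq0 lt0r_neq0.
apply: (mulfI N0'); rewrite !mulrA rm qn -!intrM ![_ * f _]mulrC.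
by rewrite -!fz e.
Qed.

Lemma tens_liftD x y : tens_lift (x + y) = tens_lift x + tens_lift y.
Proof.
have [a [b [q [-> ->]]]] := tens_common x y.
by rewrite -tens_addl !tens_liftE fD intrD mulrDr.
Qed.

Lemma tens_liftZ s x : tens_lift (s *: x) = s * tens_lift x.
Proof. by elim/tens_ind: x => a q; rewrite tens_scalerE !tens_liftE mulrA. Qed.

End TensLift.

Section Coordinates.
Variable V : finType.

Definition LQ_coord (a : LQ V) (u : V) : rat := (vsval a : QV V) u.

Lemma LQ_coordD a b u : LQ_coord (a + b) u = LQ_coord a u + LQ_coord b u.
Proof. by rewrite /LQ_coord linearD ffunE. Qed.

Lemma LQ_coordZ k a u : LQ_coord (k *: a) u = k * LQ_coord a u.
Proof. by rewrite /LQ_coord linearZ ffunE. Qed.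

Lemma LQ_coord_diff x y u : LQ_coord (std_diff x y) u = (x == u)%:R - (y == u)%:R.
Proof. by rewrite /LQ_coord std_diffE !ffunE ![u == _]eq_sym. Qed.

Lemma LQ_coord_inj a b : LQ_coord a =1 LQ_coord b -> a = b.
Proof. by move=> ab; apply/val_inj/ffunP. Qed.

Lemma LQ_coord_sum0 a : \sum_u LQ_coord a u = 0.
Proof.
have : vsval a \in lker (eps V) by exact: subvsP.
by rewrite memv_ker lfunE => /eqP.
Qed.

Lemma LQ_coord_sum I (r : seq I) (F : I -> LQ V) u :
  LQ_coord (\sum_(i <- r) F i) u = \sum_(i <- r) LQ_coord (F i) u.
Proof.
elim: r => [|i r IH]; first by rewrite !big_nil /LQ_coord linear0 ffunE.
by rewrite !big_cons LQ_coordD IH.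
Qed.

Lemma LQ_decomp (o : V) a : a = \sum_u LQ_coord a u *: std_diff u o.
Proof.
apply: LQ_coord_inj => v; rewrite LQ_coord_sum.
under eq_bigr do rewrite LQ_coordZ LQ_coord_diff mulrBr.
rewrite sumrB -mulr_suml LQ_coord_sum0 mul0r subr0 (bigD1 v) //= eqxx mulr1.
by rewrite big1 ?addr0 // => u uv; rewrite (negbTE uv) mulr0.
Qed.

Lemma LQ_ind (o : V) (P : LQ V -> Prop) : (forall a b, P a -> P b -> P (a + b)) ->
  (forall k a, P a -> P (k *: a)) -> (forall u, P (std_diff u o)) -> forall a, P a.
Proof.
move=> PD PZ Pd a; rewrite (LQ_decomp o a).
apply: (big_ind P) => // [|u _]; last exact/PZ/Pd.
by rewrite -(scale0r (std_diff o o)); apply/PZ/Pd.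
Qed.

End Coordinates.

Section Detection.
Variables (V : finType) (e : rel V).
Hypothesis e_sym : symmetric e.
Variables v v' w : V.
Hypotheses (nvw : ~~ e v w) (nv'w : ~~ e v' w).

(** [v] and [v'] act as [1 + X] and [1 + Y], [w] is the module generator 1, and all other vertices
    are trivial. Only [w] fails to commute with [v] or [v'], so edges are respected. The case
    [v = v'] is allowed and is used below. *)
Definition trunc_gen (u : V) (n : int) : trunc_group :=
  ((u == v)%:R, (u == v')%:R, (u == w)%:R, 0, 0, 0).

Lemma trunc_genC x y n : e x y ->
  (trunc_gen x n * trunc_gen y (n + 1) = trunc_gen y n * trunc_gen x (n + 1))%g.
Proof.
move=> xy; have yx : e y x by rewrite e_sym.
have mul0 z p q : e p q -> ~~ e z w -> (p == z)%:R * (q == w)%:R = 0 :> int.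
  move=> pq; have [<-|] := eqVneq p z; last by rewrite mul0r.
  by have [<-|] := eqVneq q w; [rewrite pq | rewrite mulr0].
rewrite /trunc_gen -[LHS]/(trunc_mul _ _) -[RHS]/(trunc_mul _ _) /trunc_mul.
rewrite -!mulrA !mul0 // !mulr0 !addr0 ![(y == _)%:R + _]addrC.
by [].
Qed.

Definition trunc_rep (g : bb e) : trunc_group := level_map trunc_gen 0 (val g).

Lemma trunc_repM g h : trunc_rep (g * h)%g = (trunc_rep g * trunc_rep h)%g.
Proof.
rewrite /trunc_rep bb_valM level_mapM; last exact: trunc_genC.
by have /eqP-> : chi (val g) == 0 := valP g.
Qed.

Lemma trunc_rep_diff x y : let g := trunc_rep (bb_diff e x y) in
  [/\ g.1.1.1.1.1 = (x == v)%:R - (y == v)%:R, g.1.1.1.1.2 = (x == v')%:R - (y == v')%:R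
    & g.1.1.1.2 = (x == w)%:R - (y == w)%:R].
Proof.
rewrite /trunc_rep val_bb_diff level_mapM; last exact: trunc_genC.
by rewrite level_mapV ?level_map_gen //; exact: trunc_genC.
Qed.

Definition top_form (x : grQ (bb e) 3) : rat :=
  tens_lift (fun a : gr (bb e) 3 => trunc_top (trunc_rep (grrep a))) x.

(** Two representatives differ by an element of [lcs 4], whose image has trivial top coordinate. *)
Lemma trunc_top_grrep (g : bb e) : lcs 3 g ->
  trunc_top (trunc_rep (grrep (grcls 3 g))) = trunc_top (trunc_rep g).
Proof.
move=> hg; have := trunc_deg_lcs trunc_repM (grclsK hg).
have := trunc_deg_lcs trunc_repM (grrepP (grcls 3 g)); move: (grrep _) => k hk.
have -> : g = (k * (k^-1 * g))%g by rewrite mulVKg.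
rewrite mulKg; move: (k^-1 * g)%g => l hl; rewrite trunc_repM.
move: hk hl; case: (trunc_rep k) => [[[[[s t] a] b] c] d].
case: (trunc_rep l) => [[[[[s' t'] a'] b'] c'] d'].
move=> [/(_ isT)[-> -> ->] /(_ isT)[-> ->] _] [/(_ isT)[-> -> ->] /(_ isT)[-> ->] /(_ isT) ->].
by rewrite /trunc_top /=; ring.
Qed.

Lemma trunc_topD (a b : gr (bb e) 3) : trunc_top (trunc_rep (grrep (a + b))) =
  trunc_top (trunc_rep (grrep a)) + trunc_top (trunc_rep (grrep b)).
Proof.
have ha := grrepP a; have hb := grrepP b.
rewrite -{1}(grrepK a) -{1}(grrepK b) -grclsM // trunc_top_grrep; last exact: lcs_M.
rewrite trunc_repM; move: (trunc_deg_lcs trunc_repM ha) (trunc_deg_lcs trunc_repM hb).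
case: (trunc_rep _) => [[[[[s t] a0] b0] c] d].
case: (trunc_rep _) => [[[[[s' t'] a'] b'] c'] d'].
move=> [/(_ isT)[-> -> ->] /(_ isT)[-> ->] _] [/(_ isT)[-> -> ->] /(_ isT)[-> ->] _].
by rewrite /trunc_top /=; ring.
Qed.

Lemma top_formD x y : top_form (x + y) = top_form x + top_form y.
Proof. exact/tens_liftD/trunc_topD. Qed.

Lemma top_formZ k x : top_form (k *: x) = k * top_form x.
Proof. exact/tens_liftZ/trunc_topD. Qed.

Definition cubic_form (a b c : LQ V) : rat :=
  LQ_coord a v * (LQ_coord b v' * LQ_coord c w - LQ_coord c v' * LQ_coord b w)
  + LQ_coord a v' * (LQ_coord b v * LQ_coord c w - LQ_coord c v * LQ_coord b w).

(** Both sides are trilinear, so it suffices to compare them on differences of vertices, where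
    [trunc_top_triple] evaluates the commutator. *)
Lemma top_form_cubic a b c :
  top_form (grQ_br 3 (H1_incl e a) (grQ_br 2 (H1_incl e b) (H1_incl e c)))
  = cubic_form a b c.
Proof.
elim/(LQ_ind (o := v)): a => [a a' ha ha'|k a ha|x].
- by rewrite linearD grQ_brDl top_formD ha ha' /cubic_form !LQ_coordD; ring.
- by rewrite linearZ grQ_brZl top_formZ ha /cubic_form !LQ_coordZ; ring.
elim/(LQ_ind (o := v)): b => [b b' hb hb'|k b hb|y].
- by rewrite linearD grQ_brDl grQ_brDr top_formD hb hb' /cubic_form !LQ_coordD; ring.
- by rewrite linearZ grQ_brZl grQ_brZr top_formZ hb /cubic_form !LQ_coordZ; ring.
elim/(LQ_ind (o := v)): c => [c c' hc hc'|k c hc|z].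
- by rewrite linearD !grQ_brDr top_formD hc hc' /cubic_form !LQ_coordD; ring.
- by rewrite linearZ !grQ_brZr top_formZ hc /cubic_form !LQ_coordZ; ring.
rewrite !H1_incl_std_diff (grQ_brE 2) (grQ_brE 3) !mulr1.
rewrite (@gr_brE _ 1 1) // (@gr_brE _ 1 2) //; last exact: (@lcs_R _ 1 1).
rewrite /top_form tens_liftE; last exact: trunc_topD.
rewrite mul1r trunc_top_grrep; last by apply: (@lcs_R _ 1 2) => //; apply: (@lcs_R _ 1 1).
rewrite !(mul_morphR trunc_repM).
rewrite trunc_top_triple /cubic_form !LQ_coord_diff.
have [] := trunc_rep_diff x v; have [] := trunc_rep_diff y v; have [] := trunc_rep_diff z v.
case: (trunc_rep _) => [[[[[s t] a] b] c] d].
case: (trunc_rep _) => [[[[[s1 t1] a1] b1] c1] d1].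
case: (trunc_rep _) => [[[[[s2 t2] a2] b2] c2] d2] /=.
do 8!move=> ->; move=> _.
by rewrite !(rmorphD, rmorphN, rmorphM, rmorph_nat).
Qed.

End Detection.

(** * Constraints on the support of [x] from closed walks *)

Section LinkConditions.
Variables (V : finType) (e : rel V).
Hypotheses (e_sym : symmetric e) (e_irr : irreflexive e) (e_bi : biconnected e).

Lemma connect_step (T : finType) (r : rel T) a b :
  connect r a b -> a != b -> exists c, r a c.
Proof.
case/connectP=> [[|c p]] /=; first by move=> _ ->; rewrite eqxx.
by case/andP=> ac _ _ _; exists c.
Qed.

Lemma biconnected_connect u v : connect e u v.
Proof.
have /and3P[_ /forall_inP h _] := e_bi.
have := forall_inP (h u (in_setT u)) v (in_setT v).
by apply: connect_sub => x y /and3P[_ _ xy]; apply: connect1.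
Qed.

Lemma biconnected_avoid z u v : u != z -> v != z -> connect (induced e [set~ z]) u v.
Proof.
have /and3P[_ _ /forallP/(_ z)/forall_inP h] := e_bi.
by rewrite -!in_setC1 => uz vz; exact: (forall_inP (h u uz) v vz).
Qed.

Lemma biconnected_nbr u : exists v, e u v.
Proof.
have /and3P[V3 _ _] := e_bi.
have [v] : exists v, v != u.
  apply/existsP; rewrite -negb_forall; apply: contraL V3 => /forallP all_u.
  rewrite -leqNgt (leq_trans _ (leqnSn 1)) //; apply/card_le1_eqP => x y _ _.
  by rewrite (eqP (all_u x)) (eqP (all_u y)).
by rewrite eq_sym; apply: connect_step; apply: biconnected_connect.
Qed.

Variables (X : 'End(LQ V)) (phi : V -> int) (xL : LQ V).
Hypothesis X_diff : forall u o, X (std_diff u o) = (phi u - phi o)%:~R *: xL.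
Hypothesis X_I3 : forall z, rel_ideal e 3 z -> rel_ideal e 3 (freeLie_der X z).

Section Relation.
Variables v v' w o : V.
Hypotheses (wv : w != v) (wv' : w != v') (nvw : ~~ e v w) (nv'w : ~~ e v' w).
Hypotheses (ov : o != v) (ov' : o != v') (ow : o != w).

Local Notation tform := (@top_form V e v v' w).

Definition jump u : rat := (phi u - phi o)%:~R.

Definition edge_weight (x y : V) : rat :=
  let s z : rat := (z == v)%:R in let t z : rat := (z == v')%:R in
  jump y * ((s x + s y) * t x + (t x + t y) * s x)
  - jump x * ((s x + s y) * t y + (t x + t y) * s y).

(** Every other term contains a [w]-coordinate and a [v]- or [v']-coordinate, taken at [x] and [y].
    Such products vanish because [w] differs from [v] and [v'] and is adjacent to neither. *)
Lemma top_form_edge x y : e x y ->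
  tform (lie_canon e (freeLie_der X (edge_cubic o x y)) 3) = LQ_coord xL w * edge_weight x y.
Proof.
move=> xy; rewrite /edge_cubic !freeLie_der_lie !freeLie_der_var.
rewrite lieDr !lie_canonD !agrD !lie_canon_cubic.
rewrite !(top_formD e_sym nvw nv'w) !(top_form_cubic e_sym nvw nv'w).
rewrite linearD /= !X_diff -!/(jump _) /cubic_form /edge_weight.
rewrite !(LQ_coordD, LQ_coordZ) !LQ_coord_diff.
rewrite (negbTE ov) (negbTE ov') (negbTE ow) !subr0.
have yx : e y x by rewrite e_sym.
have Nw z : e w z -> (z == v = false) * (z == v' = false).
  move=> wz; split; first by apply: contraNF nvw => /eqP <-; rewrite e_sym.
  by apply: contraNF nv'w => /eqP <-; rewrite e_sym.
have [xw|_] := eqVneq x w.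
  have wy : e w y by rewrite -xw.
  by rewrite !(Nw y wy) xw (negbTE wv) (negbTE wv') /=; ring.
have [yw|_] := eqVneq y w.
  have wx : e w x by rewrite -yw.
  by rewrite !(Nw x wx) yw (negbTE wv) (negbTE wv') /=; ring.
by move=> /=; ring.
Qed.

Lemma walk_relation x p : path e x p -> last x p = x ->
  LQ_coord xL w * walk_sum edge_weight x p = 0.
Proof.
move=> xp lp; have := X_I3 (rel_ideal_walk biconnected_connect o xp lp).
case=> _ /(congr1 (fun z => tform z)).
have t0 : tform 0 = 0.
  by apply: (addrI (tform 0)); rewrite -(top_formD e_sym nvw nv'w) !addr0.
pose g z := tform (lie_canon e (freeLie_der X z) 3).
rewrite t0 => <-; rewrite -[RHS]/(g _) (@walk_sum_morph _ _ _ g); first last.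
- move=> a b; rewrite /g linearD lie_canonD agrD; exact: (top_formD e_sym nvw nv'w).
- by rewrite /g !linear0.
elim: p x xp {lp} => [|y p IH] x /=; first by rewrite mulr0.
by case/andP=> xy /IH <-; rewrite /g top_form_edge // mulrDr.
Qed.

(** Biconnectedness joins [y1] to [y2] away from [v]. In the closed walk through [v] so obtained
    only the two edges at [v] count, since each term of [edge_weight] has a factor supported at
    [v]. *)
Lemma corner_relation y1 y2 : e v y1 -> e v y2 ->
  LQ_coord xL w * (edge_weight v y1 + edge_weight y2 v) = 0.
Proof.
move=> vy1 vy2.
have nb_v y : e v y -> y != v by move=> vy; apply: contraTneq vy => ->; rewrite e_irr.
have /connectP[p pp lp] := biconnected_avoid (nb_v _ vy1) (nb_v _ vy2).
have pe : path e y1 p by apply: sub_path pp => a b /and3P[].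
have := @walk_relation v (rcons (y1 :: p) v).
rewrite last_rcons rcons_path /= vy1 pe -lp e_sym vy2 => /(_ isT erefl).
rewrite walk_sum_rcons -lp.
suff -> : walk_sum edge_weight y1 p = 0 by rewrite add0r.
elim: p y1 {vy1 lp pe} pp => //= y p IH x /andP[/and3P[xv yv _]] /IH ->.
rewrite !in_setC1 in xv yv; rewrite /edge_weight (negbTE xv) (negbTE yv) /=; ring.
Qed.

End Relation.

(** The corner [u, p, u'] with [v = v' = p] and [w = a]: its weight is [2 (phi u - phi u')]. *)
Lemma cubic_link_vertex p u u' a : e p u -> e p u' -> phi u != phi u' ->
  LQ_coord xL a != 0 -> (a == p) || e p a.
Proof.
move=> pu pu' uu' xa; apply: contraT; rewrite negb_or => /andP[ap npa].
(* A neighbour of [a] as base vertex differs from [a], and from [p] because [a] is not adjacent to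
   [p]. *)
have [o ao] := biconnected_nbr a.
have oa : o != a by apply: contraTneq ao => ->; rewrite e_irr.
have op : o != p by apply: contraNneq npa => <-; rewrite e_sym.
have nb z : e p z -> z == p = false by move=> pz; apply: contraTF pz => /eqP->; rewrite e_irr.
have /eqP := corner_relation ap ap npa npa op op oa pu pu'.
rewrite mulf_eq0 (negbTE xa) /= /edge_weight /= (nb u pu) (nb u' pu') eqxx /=.
rewrite (_ : _ + _ = 2 * ((phi u)%:~R - (phi u')%:~R)); last by rewrite /jump !intrB; ring.
by rewrite mulf_eq0 /= subr_eq0 eqr_int (negbTE uu').
Qed.

(** The corner at [u] between [v] and another neighbour [y], detected by the pair [u, v]: the edge
    [uv] has weight [phi v - phi u] and the edge [yu] has weight zero. *)
Lemma cubic_link_edge u v a : e u v -> phi u != phi v ->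
  LQ_coord xL a != 0 -> [|| a == u, a == v, e u a | e v a].
Proof.
move=> uv juv xa; apply: contraT; rewrite !negb_or => /and4P[au av nua nva].
have [o ao] := biconnected_nbr a.
have oa : o != a by apply: contraTneq ao => ->; rewrite e_irr.
have ou : o != u by apply: contraNneq nua => <-; rewrite e_sym.
have ov : o != v by apply: contraNneq nva => <-; rewrite e_sym.
have nuv : u != v by apply: contraTneq uv => ->; rewrite e_irr.
have [y /and3P[_ yv uy]] : exists y, induced e [set~ v] u y.
  by apply: (@connect_step _ _ u a); rewrite 1?eq_sym //; apply: biconnected_avoid.
rewrite in_setC1 in yv.
have yu : y != u by apply: contraTneq uy => ->; rewrite e_irr.
have /eqP := corner_relation au av nua nva ou ov oa uv uy.
rewrite mulf_eq0 (negbTE xa) /= /edge_weight /= !eqxx (negbTE nuv) (negbTE yv) (negbTE yu).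
rewrite [v == u]eq_sym (negbTE nuv) /=.
rewrite (_ : _ + _ = (phi v)%:~R - (phi u)%:~R); last by rewrite /jump !intrB; ring.
by rewrite subr_eq0 eqr_int eq_sym (negbTE juv).
Qed.

End LinkConditions.

(** * Integral factorization of a rank-one endomorphism *)

Lemma rat_gcd (c q : rat) : exists (d : rat) (m l b g : int),
  [/\ c = m%:~R * d, q = l%:~R * d & d = b%:~R * c + g%:~R * q].
Proof.
pose C := numq c * denq q; pose Q := numq q * denq c.
pose N : rat := (denq c)%:~R * (denq q)%:~R.
have dc : (denq c)%:~R != 0 :> rat by rewrite intr_eq0 denq_neq0.
have dq : (denq q)%:~R != 0 :> rat by rewrite intr_eq0 denq_neq0.
have cE : c = C%:~R / N by rewrite /C intrM -denqM /N; field; rewrite dc dq.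
have qE : q = Q%:~R / N by rewrite /Q intrM -denqM /N; field; rewrite dc dq.
have [b [g bg]] := Bezoutz C Q.
exists ((gcdz C Q)%:~R / N), (C %/ gcdz C Q)%Z, (Q %/ gcdz C Q)%Z, b, g; split.
- by rewrite mulrA -intrM divzK ?dvdz_gcdl.
- by rewrite mulrA -intrM divzK ?dvdz_gcdr.
by rewrite -bg [in RHS]cE [in RHS]qE intrD !intrM mulrDl !mulrA.
Qed.

(** A finitely generated subgroup of the rationals is cyclic; [c] is a generator and [b] holds its
    Bezout coefficients. *)
Lemma rat_family_gcd (T : finType) (q : T -> rat) : exists (c : rat) (n b : T -> int),
  (forall i, q i = (n i)%:~R * c) /\ c = \sum_i (b i)%:~R * q i.
Proof.
suff [c [n [b [qE cE]]]] : exists (c : rat) (n b : T -> int),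
    (forall i, i \in enum T -> q i = (n i)%:~R * c) /\ c = \sum_i (b i)%:~R * q i.
  by exists c, n, b; split=> // i; apply: qE; rewrite mem_enum.
elim: (enum T) => [|j s [c [n [b [qE cE]]]]].
  by exists 0, (fun=> 0), (fun=> 0); split=> //; rewrite big1 // => i _; rewrite mul0r.
have [d [m [l [b' [g [cd jd dE]]]]]] := rat_gcd c (q j).
exists d, (fun i => if i == j then l else n i * m), (fun i => b' * b i + g *+ (i == j)).
split=> [i|].
  rewrite inE; have [->|_] := eqVneq i j; first by rewrite jd.
  by move=> /= /qE ->; rewrite {1}cd intrM mulrA.
rewrite {1}dE {1}cE mulr_sumr.
rewrite -[g%:~R * q j]add0r [in RHS](eq_bigr (fun i => b'%:~R * ((b i)%:~R * q i)
   + (g *+ (i == j))%:~R * q i)); last first.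
  by move=> i _; rewrite intrD intrM; ring.
rewrite big_split /= add0r; congr (_ + _); rewrite (bigD1 j) //= eqxx mulr1n.
by rewrite big1 ?addr0 // => i ij; rewrite (negbTE ij) mulr0n mul0r.
Qed.

Section RankOne.
Variables (V : finType) (R : 'End(WQ V)).
Hypotheses (R_int : preserves_W_lattice R) (R_rank : \dim (limg R) = 1%N).
Hypothesis R_sq : (R \o R)%VF = 0.

Definition coordW (v : V) : WQ V := linfun (fun a : LQ V => LQ_coord a v : rat^o).

Lemma coordWE v a : coordW v a = LQ_coord a v.
Proof.
have lin : linear (fun a : LQ V => LQ_coord a v : rat^o).
  by move=> k b c; rewrite LQ_coordD LQ_coordZ.
pose L := GRing.isLinear.Build rat (LQ V) rat^o _ _ lin.
pose f : {linear LQ V -> rat^o} := HB.pack (fun a : LQ V => LQ_coord a v : rat^o) L.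
exact: (lfunE f a).
Qed.

Lemma WQ_decomp (v0 : V) (f : WQ V) : f = \sum_v f (std_diff v v0) *: coordW v.
Proof.
apply/lfunP => a; rewrite {1}(LQ_decomp v0 a) linear_sum sum_lfunE.
by apply: eq_bigr => v _; rewrite linearZ scale_lfunE coordWE /= [LHS]mulrC.
Qed.

Lemma L_lattice_diff (u v : V) : L_lattice (std_diff u v).
Proof.
by move=> w; rewrite -/(LQ_coord _ w) LQ_coord_diff rpredB ?natr_int.
Qed.

(* A primitive integral generator of the line [limg R] makes both factors of
   [R = x (x) phi] integral. *)
Lemma rank_one_integral (v0 : V) : exists (phi : V -> int) (x : {ffun V -> int}) (xL : LQ V),
  [/\ forall v, LQ_coord xL v = (x v)%:~R,
      forall f a, R f a = f xL * \sum_v LQ_coord a v * (phi v)%:~R,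
      dotz (fun=> 1) x = 0 & dotz phi x = 0].
Proof.
pose psi := vpick (limg R).
have psi0 : psi != 0 by rewrite vpick0 -dimv_eq0 R_rank.
have limgE : limg R = <[psi]>%VS.
  by apply/esym/eqP; rewrite eqEdim -memvE memv_pick R_rank dim_vline psi0.
have [c [n [b [qE cE]]]] := rat_family_gcd (fun u => psi (std_diff u v0) : rat).
pose nu (a : LQ V) : rat := \sum_v LQ_coord a v * (n v)%:~R.
have psiE a : psi a = c * nu a.
  rewrite {1}(LQ_decomp v0 a) linear_sum /nu mulr_sumr; apply: eq_bigr => v _.
  transitivity (LQ_coord a v * psi (std_diff v v0)); first by rewrite linearZ.
  by rewrite qE; ring.
have c0 : c != 0.
  apply: contraNneq psi0 => c0; apply/eqP/lfunP => a.
  by rewrite psiE c0 mul0r zero_lfunE.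
have bn : \sum_i (b i)%:~R * (n i)%:~R = 1 :> rat.
  apply: (mulIf c0); rewrite mul1r [RHS]cE mulr_suml; apply: eq_bigr => i _.
  by rewrite qE mulrA.
have nu_diff u : nu (std_diff u v0) = (n u)%:~R.
  by apply: (mulfI c0); rewrite -psiE qE mulrC.
(* The Bezout combination takes the value 1 on [nu], so [k f] reads off the coefficient of [R f]
   along [nu]. *)
pose k (f : WQ V) : rat := \sum_u (b u)%:~R * R f (std_diff u v0).
have kE f a : R f a = k f * nu a.
  have : R f \in limg R by exact: memv_img (memvf f).
  rewrite limgE => /vlineP[t RfE].
  have RfE' a' : R f a' = t * (c * nu a') by rewrite RfE scale_lfunE psiE.
  rewrite RfE' /k mulrA; congr (_ * _).
  transitivity (t * c * \sum_i (b i)%:~R * (n i)%:~R); first by rewrite bn mulr1.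
  rewrite mulr_sumr; apply: eq_bigr => u _.
  by rewrite RfE' nu_diff; ring.
have k_lin : forall I (r : seq I) (F : I -> rat) (G : I -> WQ V),
    k (\sum_(i <- r) F i *: G i) = \sum_(i <- r) F i * k (G i).
  move=> I r F G; rewrite /k; under [RHS]eq_bigr do rewrite mulr_sumr.
  rewrite [RHS]exchange_big; apply: eq_bigr => u _ /=.
  rewrite linear_sum sum_lfunE mulr_sumr; apply: eq_bigr => i _.
  by rewrite linearZ scale_lfunE [in RHS]mulrCA.
pose x := [ffun v => numq (k (coordW v))] : {ffun V -> int}.
have xE v : (x v)%:~R = k (coordW v).
  (* [k] is an integral combination of values of [R (coordW v)] on lattice vectors, and [R]
     preserves the dual lattice. *)
  rewrite ffunE; apply: numqK; apply: rpred_sum => u _; apply: rpredM; first exact: intr_int.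
  apply: R_int; last exact: L_lattice_diff.
  by move=> a La; rewrite coordWE; apply: La.
pose xL : LQ V := \sum_v (x v)%:~R *: std_diff v v0.
have fxL (f : WQ V) : f xL = k f :> rat.
  rewrite {2}(WQ_decomp v0 f) k_lin linear_sum; apply: eq_bigr => v _.
  by rewrite linearZ /= [LHS]mulrC xE.
exists n, x, xL.
have xLE v : LQ_coord xL v = (x v)%:~R by rewrite -coordWE fxL xE.
split=> //.
- by move=> f a; rewrite kE fxL.
- apply/eqP; rewrite -(eqr_int rat) /dotz -[X in _ == X](LQ_coord_sum0 xL).
  rewrite [X in X == _](big_morph _ (fun a b => intrD _ a b) erefl).
  by apply/eqP/eq_bigr => v _; rewrite mul1r xLE.
(* For [f] with [R f = psi] nonzero, [k f] is nonzero, while [k f * nu xL = k (R f) = 0] by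
   [R_sq]. *)
have nuxL : nu xL = 0.
  have /memv_imgP[f _ fE] : psi \in limg R by exact: memv_pick.
  have kf : k f != 0.
    by apply: contraNneq psi0 => kf; apply/eqP/lfunP => a; rewrite fE kE kf mul0r zero_lfunE.
  have : k (R f) = 0.
    by rewrite /k big1 // => u _; rewrite -[R (R f)]comp_lfunE R_sq !zero_lfunE mulr0.
  by rewrite -fxL kE => /eqP; rewrite mulf_eq0 (negbTE kf) => /eqP.
apply/eqP; rewrite -(eqr_int rat) -[X in _ == X]nuxL /dotz /nu.
rewrite (big_morph _ (fun a b => intrD _ a b) erefl).
by apply/eqP/eq_bigr => v _; rewrite intrM xLE mulrC.
Qed.

End RankOne.

(** * From the transvection on exponents to the action on cohomology *)

Lemma LQ_coord_ab_class (V : finType) (e : rel V) (h : bb e) v :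
  LQ_coord (ab_class h) v = (expo (val h) v)%:~R.
Proof.
rewrite /LQ_coord ab_classE /exponents.
elim/raag_gen_ind: (val h) => [|u g IH|u g IH].
- by rewrite /expo !raag_hom1 !ffunE.
- by rewrite /expo !raag_homM !raag_hom_gen !ffunE IH intrD; case: (v == u).
by rewrite /expo !raag_homM !raag_homV !raag_hom_gen !ffunE IH intrD; case: (v == u).
Qed.

Theorem theorem5p11 (V : finType) (e : rel V)
    (e_sym : symmetric e) (e_irr : irreflexive e)
    (e_bi : biconnected e)
    (R : 'End(WQ V))
    (R_cubic : cubic_component_algebra e R)
    (R_int : preserves_W_lattice R)
    (R_rank : \dim (limg R) = 1%N)
    (R_sq : (R \o R)%VF = 0) :
  exists Phi : bb_aut e, forall f : WQ V, W_lattice f ->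
    rho_W Phi (H1_class f) = H1_class ((\1 + R)%VF f).
Proof.
have [v0 _] : exists v0, v0 \in [set: V].
  by apply/set0Pn; rewrite -card_gt0 cardsT; case/and3P: e_bi => /ltnW/ltnW.
have [phi [x [xL [xLE RE x0 px]]]] := rank_one_integral R_int R_rank R_sq v0.
have [_ R_I3 _] := R_cubic.
(* The dual of [R] is the transvection part [y |-> phi(y) xL], the derivation to be applied to
   [I_3]. *)
have X_diff u o : dual_end R (std_diff u o) = (phi u - phi o)%:~R *: xL.
  apply: LQ_coord_inj => v; rewrite -!coordWE dual_endE RE linearZ /= [RHS]mulrC.
  congr (_ * _); rewrite intrB.
  under eq_bigr do rewrite LQ_coord_diff mulrBl.
  rewrite sumrB; congr (_ - _).
    rewrite (bigD1 u) //= eqxx mul1r big1 ?addr0 // => w wu.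
    by rewrite eq_sym (negbTE wu) mul0r.
  rewrite (bigD1 o) //= eqxx mul1r big1 ?addr0 // => w wo.
  by rewrite eq_sym (negbTE wo) mul0r.
have xL0 a : x a != 0 -> LQ_coord xL a != 0 by rewrite xLE intr_eq0.
have nb_ex v : {w | e v w} by apply/cid/biconnected_nbr.
have [Psi PsiE] : realizable e (transv phi x).
  apply: (realizable_transv e_sym e_irr (biconnected_connect e_bi)
            (nb := fun v => sval (nb_ex v)) (fun v => svalP (nb_ex v))) => //.
  - move=> p u u' a pu pu' uu' /xL0 xa.
    exact: (cubic_link_vertex e_sym e_irr e_bi X_diff R_I3 pu pu' uu' xa).
  - move=> u v a uv juv /xL0 xa.
    exact: (cubic_link_edge e_sym e_irr e_bi X_diff R_I3 uv juv xa).
have PsiV h k : aut_inv Psi (h * k)%g = (aut_inv Psi h * aut_inv Psi k)%g.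
  by apply: (can_inj (@aut_funK _ _ Psi)); rewrite aut_funM !aut_invK.
(* [rho_W] pulls back along the inverse, so the witness is the inverse of [Psi]. *)
exists (BBAut PsiV (@aut_invK _ _ Psi) (@aut_funK _ _ Psi)) => f _.
apply/funext => h; rewrite /rho_W /H1_class /=.
rewrite !add_lfunE id_lfunE RE.
have -> : ab_class (Psi h) = ab_class h + (dotz phi (expo (val h)))%:~R *: xL.
  apply: LQ_coord_inj => v; rewrite LQ_coordD LQ_coordZ !LQ_coord_ab_class PsiE xLE.
  by rewrite ffunE intrD intrM [in RHS]mulrC.
rewrite linearD linearZ /=; congr (_ + _); rewrite [RHS]mulrC; congr (_ * _).
rewrite /dotz (big_morph _ (fun a b => intrD _ a b) erefl).
by apply: eq_bigr => v _; rewrite LQ_coord_ab_class intrM mulrC.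
Qed.
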